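(* Let $n\ge 0$ be a fixed integer and let $\varepsilon,\delta,A,\alpha$ be positive constants with $0<\alpha<1$. Consider the following four pairs of functions $(F,\sigma)$ of $t>0$ (large): \begin{enumerate} \item $F(t)=\exp\big((\log\log t)^{1+\varepsilon/2-\delta}\big)$, $\sigma(t)=1-(4+\varepsilon)\dfrac{\log\log\log t}{\log\log t}$; \item $F(t)=\exp\exp\Big(\dfrac{\log\log t}{\log\log\log t}\Big)$, $\sigma(t)=1-\dfrac{2+\eta(t)}{\log\log\log t}$; \item $F(t)=(\log\log t)^{A}$, $\sigma(t)=1-(2+\eta(t))\dfrac{\log\log\log t}{\log\log t}$; \item $F(t)=\exp\exp\big((\log\log t)^{\alpha}\big)$, $\sigma(t)=1-\dfrac{2+\eta(t)}{(\log\log t)^{1-\alpha}}$, \end{enumerate} where in cases 2--4, $\eta(t)$ denotes a suitable function with $\eta(t)\to 0$ as $t\to\infty$, whose rate of decay depends only on $\varepsilon,A,\alpha,\delta$ and $n$. Then for each of these pairs, with $$\Sigma(\sigma,T)=\{s=\sigma+it:\ \sigma(t)\le \sigma\le 1,\ t_0(\sigma)\le t\le T\}\subset\mathbb C,$$ where $t_0(\sigma)>0$ depends only on the function $\sigma$, one has $$\limsup_{\substack{s\in\Sigma(\sigma,T)\\ T\to\infty}}\frac{|\zeta^{(n)}(s)|}{F(t)}\ge 1,$$ i.e. for every $c\in(0,1)$ there are points $s=\sigma+it$ with $t$ arbitrarily large and $\sigma(t)\le\sigma\le 1$ such that $|\zeta^{(n)}(s)|> (1-c)F(t)$.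
   Context: $\zeta$ is the Riemann zeta function and $\zeta^{(n)}$ its $n$-th derivative; $s=\sigma+it$ with $t=\mathrm{Im}\,s$. The limsup is taken as the imaginary part $t\to\infty$ within the region $\sigma(t)\le \mathrm{Re}\,s\le 1$. *)

(* Defs.v *)
From Stdlib Require Import Reals Lra Lia.
From Coquelicot Require Import Coquelicot.
Open Scope R_scope.

Definition Cexp (z : C) : C := (exp (Re z) * cos (Im z), exp (Re z) * sin (Im z)).

(* x ^ z with the principal logarithm, meaningful for x > 0 *)
Definition Cpow (x : R) (z : C) : C := Cexp (z * RtoC (ln x))%C.

(* sum_(m=1)^(N+1) m^(-s)  -  (N+1)^(1-s) / (1-s) *)
Definition zeta_approx (s : C) (N : nat) : C :=
  (sum_n (fun m => Cpow (INR (S m)) (- s)) N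
   - Cpow (INR (S N)) (1 - s) / (1 - s))%C.

(* The Riemann zeta function on the half-plane Re s > 0, s <> 1, as the limit
   of zeta_approx.  By zeta_dirichlet and zeta_holomorphic below it is the
   analytic continuation of the Dirichlet series to this half-plane; the value
   elsewhere is irrelevant. *)
Definition zeta (s : C) : C :=
  (real (Lim_seq (fun N => Re (zeta_approx s N))),
   real (Lim_seq (fun N => Im (zeta_approx s N)))).

Local Definition dC (p : R -> C) (d : C) (x : R) : Prop :=
  is_derive (fun u => Re (p u)) x (Re d) /\ is_derive (fun u => Im (p u)) x (Im d).

Local Lemma Ceq (a b : C) : Re a = Re b -> Im a = Im b -> a = b.
Proof. destruct a, b; simpl; intros -> ->; reflexivity. Qed.

Local Lemma Cexp_0 : Cexp 0%C = 1%C.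
Proof. apply Ceq; simpl; rewrite exp_0, ?cos_0, ?sin_0; ring. Qed.

Local Lemma Cexp_plus (a b : C) : Cexp (a + b)%C = (Cexp a * Cexp b)%C.
Proof.
  apply Ceq; destruct a, b; simpl; rewrite exp_plus, ?cos_plus, ?sin_plus; ring.
Qed.

Local Lemma Cmod_Cexp (z : C) : Cmod (Cexp z) = exp (Re z).
Proof.
  unfold Cmod, Cexp; simpl.
  replace (_ + _) with (Rsqr (exp (Re z)) * (Rsqr (cos (Im z)) + Rsqr (sin (Im z)))).
  2: unfold Rsqr; ring.
  rewrite (Rplus_comm (Rsqr (cos _))), sin2_cos2, Rmult_1_r.
  apply sqrt_Rsqr; left; apply exp_pos.
Qed.

Local Lemma Cmod_le_abs (z : C) : Cmod z <= Rabs (Re z) + Rabs (Im z).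
Proof.
  replace z with (RtoC (Re z) + Ci * RtoC (Im z))%C at 1.
  2: apply Ceq; simpl; ring.
  eapply Rle_trans; [apply Cmod_triangle|].
  rewrite Cmod_mult, !Cmod_R.
  replace (Cmod Ci) with 1; [lra|].
  unfold Cmod, Ci; simpl.
  replace (_ + _) with 1 by ring. now rewrite sqrt_1.
Qed.

Local Lemma Re_le_Cmod (z : C) : Rabs (Re z) <= Cmod z.
Proof. apply re_le_Cmod. Qed.

Local Lemma Im_le_Cmod (z : C) : Rabs (Im z) <= Cmod z.
Proof. eapply Rle_trans; [|apply Rmax_Cmod]. apply Rmax_r. Qed.

Local Lemma dC_mult (c : C) p d x : dC p d x -> dC (fun u => c * p u)%C (c * d)%C x.
Proof.
  intros [H1 H2]; split; simpl.
  - apply (is_derive_minus (fun u => Re c * Re (p u)) (fun u => Im c * Im (p u)) x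
             (Re c * Re d) (Im c * Im d)); now apply is_derive_scal.
  - apply (is_derive_plus (fun u => Re c * Im (p u)) (fun u => Im c * Re (p u)) x
             (Re c * Im d) (Im c * Re d)); now apply is_derive_scal.
Qed.

Local Lemma dC_plus p q d e x :
  dC p d x -> dC q e x -> dC (fun u => p u + q u)%C (d + e)%C x.
Proof.
  intros [H1 H2] [H3 H4]; split; simpl.
  - now apply (is_derive_plus (fun u => Re (p u)) (fun u => Re (q u))).
  - now apply (is_derive_plus (fun u => Im (p u)) (fun u => Im (q u))).
Qed.

Local Lemma dC_const (c : C) x : dC (fun _ => c) 0%C x.
Proof. split; simpl; apply @is_derive_const. Qed.

Local Lemma dC_scal (f : R -> R) f' p d x :
  is_derive f x f' -> dC p d x ->
  dC (fun u => RtoC (f u) * p u)%C (RtoC f' * p x + RtoC (f x) * d)%C x.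
Proof.
  intros Hf [H1 H2]; split; simpl.
  - apply is_derive_ext with (fun u => f u * Re (p u)).
    { intros u. simpl. unfold Re. ring. }
    replace (_ + _) with (f' * Re (p x) + f x * Re d) by (unfold Re; ring).
    apply (is_derive_mult f (fun u => Re (p u))); auto. intros; apply Rmult_comm.
  - apply is_derive_ext with (fun u => f u * Im (p u)).
    { intros u. simpl. unfold Im. ring. }
    replace (_ + _) with (f' * Im (p x) + f x * Im d) by (unfold Im; ring).
    apply (is_derive_mult f (fun u => Im (p u))); auto. intros; apply Rmult_comm.
Qed.

Local Lemma dC_eq p d d' x : d = d' -> dC p d x -> dC p d' x.
Proof. now intros ->. Qed.

Local Lemma dC_Cexp (z : C) (f : R -> R) f' x : is_derive f x f' ->
  dC (fun u => Cexp (z * RtoC (f u)))%C (z * RtoC f' * Cexp (z * RtoC (f x)))%C x.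
Proof.
  intros Hf. assert (Ef : ex_derive f x) by now exists f'.
  apply is_derive_unique in Hf.
  destruct z as [a b].
  split; unfold Cexp; simpl; auto_derive; auto; change (Derive (fun x0 => f x0) x) with (Derive f x);
    rewrite Hf; simpl; unfold Re, Im, Rminus; simpl; ring.
Qed.

Local Lemma Cpow_pred (x : R) (z : C) : 0 < x -> Cpow x (z - 1)%C = (Cpow x z * RtoC (/ x))%C.
Proof.
  intros Hx. unfold Cpow.
  replace ((z - 1) * RtoC (ln x))%C with (z * RtoC (ln x) + RtoC (- ln x))%C.
  2: apply Ceq; simpl; ring.
  rewrite Cexp_plus. f_equal.
  unfold Cexp; apply Ceq; simpl; rewrite ?cos_0, ?sin_0, exp_Ropp, exp_ln; auto; ring.
Qed.

Local Lemma dC_Cpow (z : C) x : 0 < x -> dC (fun u => Cpow u z) (z * Cpow x (z - 1))%C x.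
Proof.
  intros Hx. rewrite Cpow_pred by auto.
  apply dC_eq with (z * RtoC (/ x) * Cexp (z * RtoC (ln x)))%C.
  { unfold Cpow; ring. }
  unfold Cpow. apply (dC_Cexp z ln (/ x)). now apply is_derive_Reals, derivable_pt_lim_ln.
Qed.

Local Lemma mvt_R (f df : R -> R) a b : a <= b ->
  (forall x, a <= x <= b -> is_derive f x (df x)) ->
  exists c, a <= c <= b /\ f b - f a = df c * (b - a).
Proof.
  intros Hab H.
  destruct (MVT_gen f a b df) as [c Hc].
  - rewrite Rmin_left, Rmax_right by auto. intros; apply H; lra.
  - rewrite Rmin_left, Rmax_right by auto. intros x Hx.
    apply derivable_continuous_pt. exists (df x). apply is_derive_Reals. now apply H.
  - rewrite Rmin_left, Rmax_right in Hc by auto. now exists c.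
Qed.

Local Lemma mvt_C (p dp : R -> C) a b K : a <= b ->
  (forall x, a <= x <= b -> dC p (dp x) x) ->
  (forall x, a <= x <= b -> Cmod (dp x) <= K) ->
  Cmod (p b - p a)%C <= 2 * (K * (b - a)).
Proof.
  intros Hab H HK.
  eapply Rle_trans; [apply Cmod_le_abs|].
  destruct (mvt_R (fun u => Re (p u)) (fun u => Re (dp u)) a b Hab) as [c [Hc E1]].
  { intros; now apply H. }
  destruct (mvt_R (fun u => Im (p u)) (fun u => Im (dp u)) a b Hab) as [c' [Hc' E2]].
  { intros; now apply H. }
  change (Re (p b - p a)%C) with (Re (p b) - Re (p a)).
  change (Im (p b - p a)%C) with (Im (p b) - Im (p a)).
  rewrite E1, E2, !Rabs_mult, (Rabs_pos_eq (b - a)) by lra.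
  assert (Rabs (Re (dp c)) <= K) by (eapply Rle_trans; [apply Re_le_Cmod|auto]).
  assert (Rabs (Im (dp c')) <= K) by (eapply Rle_trans; [apply Im_le_Cmod|auto]).
  nra.
Qed.

Local Lemma unit_step (P p dp : R -> C) a b K : b = a + 1 ->
  (forall x, a <= x <= b -> dC P (p x) x) ->
  (forall x, a <= x <= b -> dC p (dp x) x) ->
  (forall x, a <= x <= b -> Cmod (dp x) <= K) ->
  Cmod (p b - (P b - P a))%C <= 4 * K.
Proof.
  intros Hb HP Hp HK.
  assert (Hx : forall x, a <= x <= b -> Cmod (p b - p x)%C <= 2 * K).
  { intros x Hx.
    assert (0 <= K) by (eapply Rle_trans; [apply Cmod_ge_0|apply (HK x Hx)]).
    eapply Rle_trans.
    - apply (mvt_C p dp x b K); [lra| |]; intros y Hy; [apply Hp|apply HK]; lra.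
    - nra. }
  pose (Q := fun u => (p b * RtoC u - P u)%C).
  replace (p b - (P b - P a))%C with (Q b - Q a)%C.
  2: { unfold Q. rewrite Hb at 2. rewrite RtoC_plus. ring. }
  eapply Rle_trans.
  - apply (mvt_C Q (fun x => p b - p x)%C a b (2 * K)); [lra| |]; auto.
    intros x Hx1. destruct (HP x Hx1) as [H1 H2].
    split; unfold Q; simpl.
    + apply (is_derive_minus (fun u => Re (p b) * u - Im (p b) * 0)
               (fun u => Re (P u)) x (Re (p b)) (Re (p x))); auto.
      auto_derive; auto; ring.
    + apply (is_derive_minus (fun u => Re (p b) * 0 + Im (p b) * u)
               (fun u => Im (P u)) x (Im (p b)) (Im (p x))); auto.
      auto_derive; auto; ring.
  - rewrite Hb. lra.
Qed.

Local Lemma Cmod_Cpow x z : Cmod (Cpow x z) = Rpower x (Re z).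
Proof. unfold Cpow. rewrite Cmod_Cexp. unfold Rpower. f_equal. destruct z; simpl; ring. Qed.

Local Lemma Cexp_bound1 (z : C) t : 0 <= t <= 1 ->
  Cmod (Cexp (z * RtoC t) - 1)%C <= 2 * (Cmod z * exp (Cmod z)).
Proof.
  intros Ht.
  assert (H0 : 0 <= Cmod z) by apply Cmod_ge_0.
  assert (He := exp_pos (Cmod z)).
  replace (Cexp (z * RtoC t) - 1)%C with
    (Cexp (z * RtoC t) - Cexp (z * RtoC 0))%C.
  2: { rewrite Cmult_0_r. now rewrite Cexp_0. }
  eapply Rle_trans.
  - apply (mvt_C (fun u => Cexp (z * RtoC u)) (fun u => z * RtoC 1 * Cexp (z * RtoC u))%C
             0 t (Cmod z * exp (Cmod z))); [lra| |].
    + intros x _. apply (dC_Cexp z (fun u => u)). apply @is_derive_id.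
    + intros x Hx. rewrite !Cmod_mult, Cmod_R, Rabs_R1, Rmult_1_r, Cmod_Cexp.
      apply Rmult_le_compat_l; auto.
      assert (Re (z * RtoC x)%C <= Cmod z).
      { replace (Re (z * RtoC x)%C) with (Re z * x) by (destruct z; simpl; ring).
        assert (Hr := Re_le_Cmod z). apply Rabs_le_between in Hr. nra. }
      destruct H as [H|H]; [left; now apply exp_increasing|right; now rewrite H].
  - assert (0 <= Cmod z * exp (Cmod z)) by nra. nra.
Qed.

Local Lemma Cexp_bound2 (z : C) :
  Cmod (Cexp z - 1 - z)%C <= 4 * (Cmod z * Cmod z * exp (Cmod z)).
Proof.
  assert (H0 : 0 <= Cmod z) by apply Cmod_ge_0.
  pose (g := fun u => (Cexp (z * RtoC u) + z * (-1) * RtoC u)%C).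
  replace (Cexp z - 1 - z)%C with (g 1 - g 0)%C.
  2: { unfold g. rewrite Cmult_1_r, !Cmult_0_r, Cexp_0. ring. }
  eapply Rle_trans.
  - apply (mvt_C g (fun u => z * (Cexp (z * RtoC u) - 1))%C 0 1
      (Cmod z * (2 * (Cmod z * exp (Cmod z))))); [lra| |].
    + intros x _. unfold g.
      apply dC_eq with (z * RtoC 1 * Cexp (z * RtoC x) + z * (-1) * RtoC 1)%C; [ring|].
      apply (dC_plus (fun u => Cexp (z * RtoC u))%C (fun u => z * (-1) * RtoC u)%C).
      * apply (dC_Cexp z (fun u => u)). apply @is_derive_id.
      * apply (dC_mult (z * (-1))%C RtoC).
        split; simpl; [apply @is_derive_id|apply @is_derive_const].
    + intros x Hx. rewrite Cmod_mult. apply Rmult_le_compat_l; auto.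
      now apply Cexp_bound1.
  - lra.
Qed.

Local Definition clim (a : nat -> C) (l : C) : Prop :=
  is_lim_seq (fun N => Re (a N)) (Re l) /\ is_lim_seq (fun N => Im (a N)) (Im l).

Local Lemma clim_zeta s l : clim (zeta_approx s) l -> zeta s = l.
Proof.
  intros [H1 H2]. unfold zeta.
  rewrite (is_lim_seq_unique _ _ H1), (is_lim_seq_unique _ _ H2).
  now destruct l.
Qed.

Local Lemma clim_unique a l l' : clim a l -> clim a l' -> l = l'.
Proof.
  intros [H1 H2] [H3 H4]. apply Ceq.
  - apply is_lim_seq_unique in H1, H3. congruence.
  - apply is_lim_seq_unique in H2, H4. congruence.
Qed.

Local Lemma clim_ext a b l : (forall N, a N = b N) -> clim a l -> clim b l.
Proof.
  intros H [H1 H2]; split; eapply is_lim_seq_ext; eauto; intros; simpl; now rewrite H.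
Qed.

Local Lemma clim_plus a b l m : clim a l -> clim b m -> clim (fun N => a N + b N)%C (l + m)%C.
Proof.
  intros [H1 H2] [H3 H4]; split; simpl; now apply (is_lim_seq_plus' _ _ _ _).
Qed.

Local Lemma clim_mult c a l : clim a l -> clim (fun N => c * a N)%C (c * l)%C.
Proof.
  intros [H1 H2]; split; simpl.
  - apply (is_lim_seq_minus' (fun N => Re c * Re (a N)) (fun N => Im c * Im (a N))).
    + apply (is_lim_seq_scal_l _ (Re c) (Re l)); auto.
    + apply (is_lim_seq_scal_l _ (Im c) (Im l)); auto.
  - apply (is_lim_seq_plus' (fun N => Re c * Im (a N)) (fun N => Im c * Re (a N))).
    + apply (is_lim_seq_scal_l _ (Re c) (Im l)); auto.
    + apply (is_lim_seq_scal_l _ (Im c) (Re l)); auto.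
Qed.

Local Lemma seq_conv_R (a b : nat -> R) :
  (forall N, Rabs (a (S N) - a N) <= b N) -> ex_series b ->
  exists l : R, is_lim_seq a l /\ Rabs (l - a O) <= Series b.
Proof.
  intros H Hb.
  assert (Hd : ex_series (fun N => Rabs (a (S N) - a N))).
  { apply (@ex_series_le R_AbsRing R_CompleteNormedModule) with b; auto.
    intros N. unfold norm; simpl. unfold abs; simpl. rewrite Rabs_Rabsolu. auto. }
  assert (Hs := ex_series_Rabs _ Hd).
  exists (a O + Series (fun N => a (S N) - a N)). split.
  - apply is_lim_seq_incr_1.
    apply is_lim_seq_ext with (fun N => a O + sum_n (fun N => a (S N) - a N) N).
    { induction n as [|n IH]; [rewrite sum_O; ring|].
      rewrite sum_Sn. unfold plus; simpl. rewrite <- Rplus_assoc, IH. ring. }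
    apply (is_lim_seq_plus' (fun _ => a O)); [apply is_lim_seq_const|].
    now apply Series_correct in Hs.
  - replace (_ - _) with (Series (fun N => a (S N) - a N)) by ring.
    eapply Rle_trans; [now apply Series_Rabs|].
    apply Series_le; auto. intros; split; auto. apply Rabs_pos.
Qed.

Local Lemma seq_conv_C (a : nat -> C) (b : nat -> R) :
  (forall N, Cmod (a (S N) - a N)%C <= b N) -> ex_series b ->
  exists l : C, clim a l /\ Cmod (l - a O)%C <= 2 * Series b.
Proof.
  intros H Hb.
  destruct (seq_conv_R (fun N => Re (a N)) b) as [l1 [H1 H1']]; auto.
  { intros N. eapply Rle_trans; [apply (Re_le_Cmod (a (S N) - a N)%C)|auto]. }
  destruct (seq_conv_R (fun N => Im (a N)) b) as [l2 [H2 H2']]; auto.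
  { intros N. eapply Rle_trans; [apply (Im_le_Cmod (a (S N) - a N)%C)|auto]. }
  exists (l1, l2); split; [now split|].
  eapply Rle_trans; [apply Cmod_le_abs|].
  change (Rabs (l1 - Re (a O)) + Rabs (l2 - Im (a O)) <= 2 * Series b). lra.
Qed.

Local Lemma INR_S_pos N : 1 <= INR (S N).
Proof. rewrite S_INR. assert (H := pos_INR N). lra. Qed.

Local Lemma Rpower_neg_le x y c : 0 < x <= y -> c <= 0 -> Rpower y c <= Rpower x c.
Proof.
  intros Hx Hc. unfold Rpower.
  assert (ln x <= ln y) by (apply ln_le; lra).
  assert (c * ln y <= c * ln x) by nra.
  destruct H0 as [H0|H0]; [left; now apply exp_increasing|right; now rewrite H0].
Qed.

Local Lemma p_series c : 0 < c -> ex_series (fun N => Rpower (INR (S N)) (-1 - c)).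
Proof.
  intros Hc. apply ex_series_incr_1.
  assert (Hstep : forall N, Rpower (INR (S (S N))) (-1 - c)
    <= / c * (Rpower (INR (S N)) (- c) - Rpower (INR (S (S N))) (- c))).
  { intros N. assert (HN := INR_S_pos N). assert (HS := S_INR (S N)).
    destruct (mvt_R (fun x => Rpower x (- c)) (fun x => - c * Rpower x (- c - 1))
                (INR (S N)) (INR (S (S N)))) as [x [Hx E]]; [lra| |].
    { intros x Hx. apply is_derive_Reals, derivable_pt_lim_power. lra. }
    replace (INR (S (S N)) - INR (S N)) with 1 in E by lra.
    replace (Rpower _ (- c) - Rpower _ (- c)) with (c * Rpower x (- c - 1)) by lra.
    rewrite <- Rmult_assoc, Rinv_l, Rmult_1_l by lra.
    replace (- c - 1) with (-1 - c) by ring.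
    apply Rpower_neg_le; lra. }
  assert (Hsum : forall N, sum_n (fun N => Rpower (INR (S (S N))) (-1 - c)) N
    <= / c * (1 - Rpower (INR (S (S N))) (- c))).
  { induction N as [|N IH].
    - rewrite sum_O. eapply Rle_trans; [apply Hstep|]. right. f_equal. f_equal.
      unfold Rpower. simpl. now rewrite ln_1, Rmult_0_r, exp_0.
    - rewrite sum_Sn. unfold plus; simpl plus.
      specialize (Hstep (S N)). 
      replace (/ c * (1 - Rpower (INR (S (S (S N)))) (- c))) with
        (/ c * (1 - Rpower (INR (S (S N))) (- c)) +
         / c * (Rpower (INR (S (S N))) (- c) - Rpower (INR (S (S (S N)))) (- c))) by ring.
      now apply Rplus_le_compat. }
  destruct (ex_finite_lim_seq_incr (sum_n (fun N => Rpower (INR (S (S N))) (-1 - c))) (/ c))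
    as [l Hl].
  - intros N. rewrite sum_Sn. unfold plus; simpl plus.
    assert (0 < Rpower (INR (S (S (S N)))) (-1 - c)) by apply exp_pos.
    unfold plus; cbv beta; simpl AbelianGroup.sort in *. 
    rewrite <- (Rplus_0_r (sum_n _ N)) at 1. apply Rplus_le_compat_l. lra.
  - intros N. eapply Rle_trans; [apply Hsum|].
    rewrite <- (Rmult_1_r (/ c)) at 2. apply Rmult_le_compat_l.
    + left; now apply Rinv_0_lt_compat.
    + assert (0 < Rpower (INR (S (S N))) (- c)) by apply exp_pos. lra.
  - now exists l.
Qed.
Local Lemma zeta_approx_S s N : zeta_approx s (S N) = (zeta_approx s N +
  (Cpow (INR (S (S N))) (- s) - (Cpow (INR (S (S N))) (1 - s) / (1 - s)
     - Cpow (INR (S N)) (1 - s) / (1 - s))))%C.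
Proof.
  unfold zeta_approx. rewrite sum_Sn. unfold Cdiv.
  change (plus ?x ?y) with (x + y)%C. ring.
Qed.

Local Lemma dC_P (w : C) x : w <> 0%C -> 0 < x ->
  dC (fun u => Cpow u w / w)%C (Cpow x (w - 1)) x.
Proof.
  intros Hw Hx.
  apply dC_eq with (/ w * (w * Cpow x (w - 1)))%C; [now field|].
  assert (H := dC_mult (/ w)%C _ _ _ (dC_Cpow w x Hx)).
  destruct H as [H1 H2]; split.
  - eapply is_derive_ext; [|exact H1]. intros u. apply (f_equal Re). unfold Cdiv. ring.
  - eapply is_derive_ext; [|exact H2]. intros u. apply (f_equal Im). unfold Cdiv. ring.
Qed.

Local Lemma clim_zeta_approx s : 0 < Re s -> s <> 1%C -> clim (zeta_approx s) (zeta s).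
Proof.
  intros Hs Hs1.
  assert (Hw : (1 - s)%C <> 0%C).
  { intros E. apply Hs1. replace s with (1 - (1 - s))%C by ring. rewrite E. ring. }
  destruct (seq_conv_C (zeta_approx s)
              (fun N => (4 * Cmod s) * Rpower (INR (S N)) (-1 - Re s))) as [l [Hl _]].
  - intros N. rewrite zeta_approx_S.
    assert (HN := INR_S_pos N).
    match goal with |- Cmod (?u + ?d - ?u)%C <= _ => replace (u + d - u)%C with d by ring end.
    rewrite Rmult_assoc.
    apply (unit_step (fun u => Cpow u (1 - s) / (1 - s))%C (fun u => Cpow u (- s))
             (fun u => - s * Cpow u (- s - 1))%C (INR (S N))).
    + now rewrite (S_INR (S N)).
    + intros x Hx. replace (- s)%C with (1 - s - 1)%C by ring.
      apply dC_P; auto; lra.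
    + intros x Hx. apply dC_Cpow; lra.
    + intros x Hx. rewrite Cmod_mult, Cmod_opp, Cmod_Cpow.
      apply Rmult_le_compat_l; [apply Cmod_ge_0|].
      replace (Re (- s - 1)%C) with (-1 - Re s) by (destruct s; simpl; ring).
      apply Rpower_neg_le; lra.
  - apply (@ex_series_scal R_AbsRing R_NormedModule). now apply p_series.
  - now rewrite (clim_zeta s l Hl).
Qed.

Local Lemma clim_Cmod_0 a : is_lim_seq (fun N => Cmod (a N)) 0 -> clim a 0%C.
Proof.
  intros H; split; simpl; apply is_lim_seq_abs_0;
    apply is_lim_seq_le_le with (u := fun _ => 0) (w := fun N => Cmod (a N)); auto;
    try apply is_lim_seq_const; intros N; split; try apply Rabs_pos.
  - apply Re_le_Cmod.
  - apply Im_le_Cmod.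
Qed.

Local Lemma Rpower_lim_0 c : c < 0 -> is_lim_seq (fun N => Rpower (INR (S N)) c) 0.
Proof.
  intros Hc. unfold Rpower.
  apply (is_lim_comp_seq exp _ m_infty 0).
  - apply is_lim_exp_m.
  - now exists O.
  - replace m_infty with (Rbar_mult c p_infty).
    + apply (is_lim_seq_scal_l _ c p_infty).
      apply (is_lim_comp_seq ln _ p_infty p_infty).
      * apply is_lim_ln_p.
      * now exists O.
      * apply -> (is_lim_seq_incr_1 INR p_infty). apply is_lim_seq_INR.
    + simpl. destruct (Rle_dec 0 c) as [H|H]; [exfalso; lra|reflexivity].
Qed.

Local Lemma clim_filterlim a l : clim a l -> filterlim a eventually (@locally C_NormedModule l).
Proof.
  intros [H1 H2]. apply is_lim_seq_spec in H1, H2.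
  apply filterlim_locally. intros eps.
  generalize (filter_and _ _ (H1 eps) (H2 eps)). apply filter_imp.
  intros N [E1 E2]. split; [exact E1|exact E2].
Qed.

Lemma zeta_dirichlet (s : C) : 1 < Re s ->
  @is_series C_AbsRing C_NormedModule (fun m => Cpow (INR (S m)) (- s)) (zeta s).
Proof.
  intros Hs.
  assert (Hs1 : s <> 1%C) by (intros ->; simpl in Hs; lra).
  apply clim_filterlim.
  rewrite <- (Cplus_0_r (zeta s)), <- (Cmult_0_r (/ (1 - s))%C).
  apply clim_ext with
    (fun N => zeta_approx s N + / (1 - s) * Cpow (INR (S N)) (1 - s))%C.
  - intros N. unfold zeta_approx, Cdiv.
    set (a := sum_n _ N). match goal with |- _ = ?b => change b with a end. ring.
  - apply clim_plus; [apply clim_zeta_approx; auto; lra|].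
    apply clim_mult, clim_Cmod_0.
    apply is_lim_seq_ext with (fun N => Rpower (INR (S N)) (1 - Re s)).
    + intros N. rewrite Cmod_Cpow. f_equal.
    + apply Rpower_lim_0. lra.
Qed.

Local Definition dapprox (s : C) (N : nat) : C :=
  (sum_n (fun m => (-1) * (RtoC (ln (INR (S m))) * Cpow (INR (S m)) (- s)))%C N
   + RtoC (ln (INR (S N))) * (Cpow (INR (S N)) (1 - s) / (1 - s))
   - Cpow (INR (S N)) (1 - s) / (1 - s) / (1 - s))%C.

Local Definition rem (s h : C) (x : R) : C :=
  (Cpow x (- s - h) + (-1) * Cpow x (- s) + h * (RtoC (ln x) * Cpow x (- s)))%C.
Local Definition drem (s h : C) (x : R) : C :=
  ((- s - h) * Cpow x (- s - h - 1) + (-1) * (- s * Cpow x (- s - 1))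
   + h * (RtoC (/ x) * Cpow x (- s) + RtoC (ln x) * (- s * Cpow x (- s - 1))))%C.
Local Definition Prem (s h : C) (x : R) : C :=
  (Cpow x (1 - s - h) / (1 - s - h) + (-1) * (Cpow x (1 - s) / (1 - s))
   + h * (RtoC (ln x) * (Cpow x (1 - s) / (1 - s))
          + (- / (1 - s)) * (Cpow x (1 - s) / (1 - s))))%C.

Local Lemma is_derive_ln' x : 0 < x -> is_derive ln x (/ x).
Proof. intros Hx. now apply is_derive_Reals, derivable_pt_lim_ln. Qed.

Local Lemma dC_rem s h x : 0 < x -> dC (rem s h) (drem s h x) x.
Proof.
  intros Hx. unfold rem, drem.
  apply (dC_plus (fun x => Cpow x (- s - h) + (-1) * Cpow x (- s))%C).
  - apply (dC_plus (fun x => Cpow x (- s - h))); [now apply dC_Cpow|].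
    apply dC_mult. now apply dC_Cpow.
  - apply dC_mult. apply dC_scal; [now apply is_derive_ln'|now apply dC_Cpow].
Qed.

Local Lemma dC_Prem s h x : (1 - s)%C <> 0%C -> (1 - s - h)%C <> 0%C -> 0 < x ->
  dC (Prem s h) (rem s h x) x.
Proof.
  intros H1 H2 Hx. unfold Prem.
  apply dC_eq with (Cpow x (1 - s - h - 1) + (-1) * Cpow x (1 - s - 1) +
    h * ((RtoC (/ x) * (Cpow x (1 - s) / (1 - s)) + RtoC (ln x) * Cpow x (1 - s - 1))
         + (- / (1 - s)) * Cpow x (1 - s - 1)))%C.
  { unfold rem.
    replace (1 - s - h - 1)%C with (- s - h)%C by ring.
    rewrite (Cpow_pred x (1 - s)) by auto.
    replace (Cpow x (- s)) with (Cpow x (1 - s) * RtoC (/ x))%C.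
    2: { rewrite <- Cpow_pred by auto. f_equal. ring. }
    field. auto. }
  apply (dC_plus (fun x => Cpow x (1 - s - h) / (1 - s - h)
      + (-1) * (Cpow x (1 - s) / (1 - s)))%C).
  - apply (dC_plus (fun x => Cpow x (1 - s - h) / (1 - s - h))%C); [now apply dC_P|].
    apply dC_mult. now apply dC_P.
  - apply dC_mult.
    apply (dC_plus (fun x => RtoC (ln x) * (Cpow x (1 - s) / (1 - s)))%C).
    + apply (dC_scal ln (/ x) (fun x => Cpow x (1 - s) / (1 - s))%C);
        [now apply is_derive_ln'|now apply dC_P].
    + apply dC_mult. now apply dC_P.
Qed.

Local Lemma ln_le_Rpower x c : 0 < c -> 1 <= x -> 0 <= ln x <= / c * Rpower x c.
Proof.
  intros Hc Hx. split.
  - rewrite <- ln_1. apply ln_le; lra.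
  - unfold Rpower. assert (H := exp_ineq1_le (c * ln x)).
    apply Rmult_le_reg_l with c; auto. rewrite <- Rmult_assoc, Rinv_r, Rmult_1_l by lra. lra.
Qed.

Local Lemma drem_bound s : 0 < Re s -> exists K, 0 <= K /\ forall h x,
  Cmod h <= Re s / 4 -> 1 <= x ->
  Cmod (drem s h x) <= K * (Cmod h * Cmod h) * Rpower x (-1 - Re s / 4).
Proof.
  intros Hs. set (c := Re s / 4). assert (Hc : 0 < c) by (unfold c; lra).
  exists ((Cmod s + c) * (4 * (/ c * / c)) + / c).
  assert (Hs0 := Cmod_ge_0 s). assert (Hic : 0 < / c) by now apply Rinv_0_lt_compat.
  assert (HK : 0 <= (Cmod s + c) * (4 * (/ c * / c))).
  { apply Rmult_le_pos; [lra|]. nra. }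
  split; [lra|]. intros h x Hh Hx.
  assert (Hh0 := Cmod_ge_0 h).
  destruct (ln_le_Rpower x c Hc Hx) as [HL0 HL].
  set (L := ln x) in *.
  assert (E : drem s h x = (Cpow x (- s - 1) *
     (- ((s + h) * (Cexp (- h * RtoC L) - 1 - (- h * RtoC L))) + h * h * RtoC L))%C).
  { unfold drem. fold L.
    replace (RtoC (/ x) * Cpow x (- s))%C with (Cpow x (- s - 1)).
    2: { rewrite Cpow_pred by lra. ring. }
    replace (Cpow x (- s - h - 1)) with (Cpow x (- s - 1) * Cexp (- h * RtoC L))%C.
    2: { unfold Cpow. rewrite <- Cexp_plus. f_equal. fold L. ring. }
    ring. }
  rewrite E, Cmod_mult, Cmod_Cpow.
  replace (Re (- s - 1)%C) with (-1 - 4 * c) by (unfold c; destruct s; simpl; lra).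
  set (X := Rpower x c) in *.
  assert (HX : 0 < X) by apply exp_pos.
  assert (HX1 : 1 <= X).
  { unfold X. rewrite <- (Rpower_O x) by lra. apply Rle_Rpower; lra. }
  assert (EY : Rpower x (-1 - c) = Rpower x (-1 - 4 * c) * (X * X * X)).
  { unfold X. rewrite <- !Rpower_plus. f_equal. ring. }
  rewrite EY.
  set (Y := Rpower x (-1 - 4 * c)). assert (HY : 0 < Y) by apply exp_pos.
  assert (B1 : Cmod (Cexp (- h * RtoC L) - 1 - (- h * RtoC L))%C
     <= 4 * (/ c * / c) * (Cmod h * Cmod h) * (X * X * X)).
  { eapply Rle_trans; [apply Cexp_bound2|].
    assert (Eh : Cmod (- h * RtoC L)%C = Cmod h * L).
    { rewrite Cmod_mult, Cmod_opp, Cmod_R, Rabs_pos_eq; auto. }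
    rewrite Eh.
    assert (He : exp (Cmod h * L) <= X).
    { unfold X, Rpower. fold L.
      assert (Cmod h * L <= c * L) by (apply Rmult_le_compat_r; auto).
      destruct H as [H|H]; [left; now apply exp_increasing|right; now rewrite H]. }
    assert (HLL : L * L <= (/ c * X) * (/ c * X)) by (apply Rmult_le_compat; auto).
    assert (He0 := exp_pos (Cmod h * L)).
    replace (4 * (/ c * / c) * (Cmod h * Cmod h) * (X * X * X)) with
      (4 * ((Cmod h * Cmod h) * ((/ c * X) * (/ c * X)) * X)) by ring.
    apply Rmult_le_compat_l; [lra|].
    apply Rmult_le_compat; auto; [|lra|].
    - apply Rmult_le_pos; apply Rmult_le_pos; auto.
    - replace (Cmod h * L * (Cmod h * L)) with (Cmod h * Cmod h * (L * L)) by ring.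
      apply Rmult_le_compat_l; auto. now apply Rmult_le_pos. }
  apply Rle_trans with (Y * (((Cmod s + c) * (4 * (/ c * / c)) + / c)
     * (Cmod h * Cmod h) * (X * X * X))).
  2: { right; ring. }
  apply Rmult_le_compat_l; [lra|].
  eapply Rle_trans; [apply Cmod_triangle|].
  rewrite Cmod_opp, !Cmod_mult, Cmod_R, (Rabs_pos_eq L) by auto.
  assert (B2 : Cmod (s + h)%C <= Cmod s + c).
  { eapply Rle_trans; [apply Cmod_triangle|]. lra. }
  assert (Hhh : 0 <= Cmod h * Cmod h) by now apply Rmult_le_pos.
  assert (B3 : L <= / c * (X * X * X)).
  { eapply Rle_trans; [exact HL|]. apply Rmult_le_compat_l; [lra|]. nra. }
  replace (((Cmod s + c) * (4 * (/ c * / c)) + / c) * (Cmod h * Cmod h) * (X * X * X)) with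
   ((Cmod s + c) * (4 * (/ c * / c) * (Cmod h * Cmod h) * (X * X * X))
     + Cmod h * Cmod h * (/ c * (X * X * X))) by ring.
  apply Rplus_le_compat.
  - apply Rmult_le_compat; auto; apply Cmod_ge_0.
  - now apply Rmult_le_compat_l.
Qed.

Local Definition D (s h : C) (N : nat) : C :=
  (zeta_approx (s + h) N + (-1) * zeta_approx s N + (- h) * dapprox s N)%C.

Local Lemma D_S s h N : D s h (S N) = (D s h N + (rem s h (INR (S (S N)))
  - (Prem s h (INR (S (S N))) - Prem s h (INR (S N)))))%C.
Proof.
  unfold D. rewrite !zeta_approx_S. unfold dapprox. rewrite sum_Sn.
  change (plus ?x ?y) with (x + y)%C.
  unfold rem, Prem, Cdiv.
  replace (1 - (s + h))%C with (1 - s - h)%C by ring.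
  replace (- (s + h))%C with (- s - h)%C by ring.
  ring.
Qed.

Local Lemma Cpow_1 z : Cpow (INR 1) z = 1%C.
Proof. unfold Cpow. simpl INR. rewrite ln_1, Cmult_0_r. apply Cexp_0. Qed.

Local Lemma D_0 s h : (1 - s)%C <> 0%C -> (1 - s - h)%C <> 0%C ->
  D s h O = (- (h * h) / ((1 - s - h) * ((1 - s) * (1 - s))))%C.
Proof.
  intros H1 H2. unfold D, zeta_approx, dapprox.
  rewrite !sum_O, !Cpow_1. simpl INR. rewrite ln_1.
  replace (1 - (s + h))%C with (1 - s - h)%C by ring.
  field. split; auto.
Qed.

Local Lemma D_conv s : 0 < Re s -> s <> 1%C -> exists K d, 0 < d /\ 0 <= K /\
  forall h, Cmod h <= d -> 0 < Re (s + h)%C /\ (s + h)%C <> 1%C /\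
    exists l, clim (D s h) l /\ Cmod l <= K * (Cmod h * Cmod h).
Proof.
  intros Hs Hs1.
  assert (Hw : (1 - s)%C <> 0%C).
  { intros E. apply Hs1. replace s with (1 - (1 - s))%C by ring. rewrite E. ring. }
  assert (Hw0 := proj1 (Cmod_gt_0 _) Hw). set (W := Cmod (1 - s)%C) in *.
  destruct (drem_bound s Hs) as [K [HK HB]].
  assert (Hc : 0 < Re s / 4) by lra.
  assert (Hex := p_series _ Hc).
  set (b := fun N => Rpower (INR (S N)) (-1 - Re s / 4)) in *.
  assert (Hb0 : 0 <= Series b).
  { rewrite <- (Rmult_0_l (Series b)), <- Series_scal_l.
    apply Series_le; auto. intros N. rewrite Rmult_0_l.
    split; [lra|left; apply exp_pos]. }
  assert (HiW : 0 < / (W / 2 * (W * W))).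
  { apply Rinv_0_lt_compat. apply Rmult_lt_0_compat; [lra|nra]. }
  exists (/ (W / 2 * (W * W)) + 2 * (4 * K * Series b)), (Rmin (Re s / 4) (W / 2)).
  split; [apply Rmin_glb_lt; lra|].
  split. { assert (0 <= K * Series b) by now apply Rmult_le_pos. lra. }
  intros h Hh.
  assert (Hh1 : Cmod h <= Re s / 4) by (eapply Rle_trans; [apply Hh|apply Rmin_l]).
  assert (Hh2 : Cmod h <= W / 2) by (eapply Rle_trans; [apply Hh|apply Rmin_r]).
  assert (Hwh : W / 2 <= Cmod (1 - s - h)%C).
  { assert (W <= Cmod (1 - s - h)%C + Cmod h).
    { unfold W. replace (1 - s)%C with (1 - s - h + h)%C at 1 by ring. apply Cmod_triangle. }
    lra. }
  assert (Hwh0 : (1 - s - h)%C <> 0%C).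
  { intros E. rewrite E, Cmod_0 in Hwh. lra. }
  split.
  { assert (H := Re_le_Cmod h). apply Rabs_le_between in H.
    change (Re (s + h)%C) with (Re s + Re h). lra. }
  split. { intros E. apply Hwh0. replace (1 - s - h)%C with (1 - (s + h))%C by ring.
           rewrite E. ring. }
  destruct (seq_conv_C (D s h) (fun N => (4 * (K * (Cmod h * Cmod h))) * b N)) as [l [Hl Hl']].
  - intros N. rewrite D_S.
    assert (HN := INR_S_pos N).
    match goal with |- Cmod (?u + ?d - ?u)%C <= _ => replace (u + d - u)%C with d by ring end.
    rewrite (Rmult_assoc 4).
    apply (unit_step (Prem s h) (rem s h) (drem s h) (INR (S N))).
    + now rewrite (S_INR (S N)).
    + intros x Hx. apply dC_Prem; auto; lra.
    + intros x Hx. apply dC_rem; lra.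
    + intros x Hx. eapply Rle_trans; [apply HB; auto; lra|].
      apply Rmult_le_compat_l.
      * apply Rmult_le_pos; auto. apply Rmult_le_pos; apply Cmod_ge_0.
      * apply Rpower_neg_le; lra.
  - now apply (@ex_series_scal R_AbsRing R_NormedModule).
  - exists l; split; auto.
    rewrite Series_scal_l in Hl'.
    replace l with (l - D s h O + D s h O)%C by ring.
    eapply Rle_trans; [apply Cmod_triangle|].
    assert (HD : Cmod (D s h O) <= / (W / 2 * (W * W)) * (Cmod h * Cmod h)).
    { rewrite D_0 by auto.
      assert (Hne : ((1 - s - h) * ((1 - s) * (1 - s)))%C <> 0%C)
        by (apply Cmult_neq_0; auto; now apply Cmult_neq_0).
      rewrite Cmod_div by auto.
      rewrite Cmod_opp, !Cmod_mult. fold W.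
      unfold Rdiv at 1. rewrite Rmult_comm.
      apply Rmult_le_compat_r; [apply Rmult_le_pos; apply Cmod_ge_0|].
      apply Rinv_le_contravar; [apply Rmult_lt_0_compat; nra|].
      apply Rmult_le_compat_r; [nra|auto]. }
    lra.
Qed.

Local Lemma is_derive_quadratic (f : C -> C) (s v : C) K d : 0 < d -> 0 <= K ->
  (forall h, Cmod h <= d -> Cmod (f (s + h) - f s - h * v)%C <= K * (Cmod h * Cmod h)) ->
  @is_derive C_AbsRing C_NormedModule f s v.
Proof.
  intros Hd HK H. split; [apply @is_linear_scal_l|].
  intros x Hx eps. apply (@is_filter_lim_locally_unique C_AbsRing (AbsRing_NormedModule C_AbsRing)) in Hx. 
  subst x.
  assert (Hr : 0 < Rmin d (eps / (K + 1))).
  { apply Rmin_glb_lt; auto. apply Rdiv_lt_0_compat; [apply eps|lra]. }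
  apply (@locally_le_locally_norm C_AbsRing (AbsRing_NormedModule C_AbsRing)).
  exists (mkposreal _ Hr). intros y Hy.
  unfold ball_norm in Hy. simpl in Hy.
  set (h := (y - s)%C).
  change (Cmod h < Rmin d (eps / (K + 1))) in Hy.
  change (Cmod (f y - f s - h * v)%C <= eps * Cmod h).
  replace y with (s + h)%C by (unfold h; ring).
  assert (Hy1 := Rlt_le_trans _ _ _ Hy (Rmin_l _ _)).
  assert (Hy2 := Rlt_le_trans _ _ _ Hy (Rmin_r _ _)).
  eapply Rle_trans; [apply H; lra|].
  rewrite <- Rmult_assoc. apply Rmult_le_compat_r; [apply Cmod_ge_0|].
  apply Rmult_lt_compat_l with (r := K + 1) in Hy2; [|lra].
  replace ((K + 1) * (eps / (K + 1))) with (pos eps) in Hy2 by (field; lra).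
  assert (H0 := Cmod_ge_0 h). nra.
Qed.

Lemma zeta_holomorphic (s : C) : 0 < Re s -> s <> 1%C ->
  @ex_derive C_AbsRing C_NormedModule zeta s.
Proof.
  intros Hs Hs1.
  destruct (D_conv s Hs Hs1) as [K [d [Hd [HK H]]]].
  assert (Hz := clim_zeta_approx s Hs Hs1).
  assert (Hv : exists v, clim (dapprox s) v).
  { destruct (H (RtoC d)) as [E1 [E2 [l [Hl _]]]].
    { rewrite Cmod_R, Rabs_pos_eq; lra. }
    assert (Hzh := clim_zeta_approx _ E1 E2).
    assert (Hd0 : RtoC d <> 0%C) by (intros E; apply RtoC_inj in E; lra).
    exists (- / RtoC d * (l + ((-1) * zeta (s + RtoC d) + zeta s)))%C.
    apply clim_ext with (fun N => - / RtoC d * (D s (RtoC d) N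
       + ((-1) * zeta_approx (s + RtoC d) N + zeta_approx s N)))%C.
    - intros N. unfold D. field. auto.
    - apply clim_mult, clim_plus; auto. apply clim_plus; auto. now apply clim_mult. }
  destruct Hv as [v Hv]. exists v.
  apply is_derive_quadratic with K d; auto.
  intros h Hh. destruct (H h Hh) as [E1 [E2 [l [Hl Hl']]]].
  assert (Hzh := clim_zeta_approx _ E1 E2).
  replace (zeta (s + h) - zeta s - h * v)%C with l; auto.
  apply clim_unique with (1 := Hl).
  replace (zeta (s + h) - zeta s - h * v)%C with
    (zeta (s + h) + (-1) * zeta s + (- h) * v)%C by ring.
  unfold D. apply clim_plus; [apply clim_plus|]; auto; now apply clim_mult.
Qed.

Definition zeta_deriv (n : nat) : C -> C := Nat.iter n C_derive zeta.

Definition Sigma (sigma : R -> R) (t0 T : R) (s : C) : Prop :=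
  sigma (Im s) <= Re s <= 1 /\ t0 <= Im s <= T.

(* The limsup of g(s) as Im s tends to infinity with s in some Sigma(sigma, T):
   the infimum over t1 of the supremum of g over the points with Im s >= t1. *)
Definition limsup_Sigma (sigma : R -> R) (t0 : R) (g : C -> R) : Rbar :=
  Rbar_glb (fun y => exists t1 : R, y = Lub_Rbar (fun x =>
    exists (s : C) (T : R), Sigma sigma t0 T s /\ t1 <= Im s /\ x = g s)).

Lemma limsup_Sigma_ge1 sigma t0 g :
  Rbar_le 1 (limsup_Sigma sigma t0 g) <->
  forall c t1, 0 < c < 1 -> exists (s : C) (T : R),
    Sigma sigma t0 T s /\ t1 <= Im s /\ 1 - c < g s.
Proof.
  unfold limsup_Sigma, Rbar_glb.
  match goal with |- context [proj1_sig ?X] => destruct X as [l [Hl1 Hl2]] end; simpl.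
  split.
  - intros H c t1 Hc. apply Classical_Prop.NNPP; intros Hn.
    assert (H1 := Hl1 _ (ex_intro _ t1 eq_refl)).
    assert (H2 : Rbar_le 1 (1 - c)).
    { eapply Rbar_le_trans; [exact H|]. eapply Rbar_le_trans; [exact H1|].
      apply (proj2 (Lub_Rbar_correct _)).
      intros x [s [T [E1 [E2 E3]]]]. simpl.
      destruct (Rle_lt_dec x (1 - c)) as [Hx|Hx]; auto.
      exfalso. apply Hn. exists s, T. subst x. auto. }
    simpl in H2. lra.
  - intros H. apply (Hl2 (Finite 1)). intros y [t1 ->].
    match goal with |- Rbar_le _ (Lub_Rbar ?E) =>
      assert (HE : forall x, E x -> Rbar_le x (Lub_Rbar E))
        by exact (proj1 (Lub_Rbar_correct E));
      set (L := Lub_Rbar E) in * end.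
    assert (Hc : forall c, 0 < c < 1 -> Rbar_le (1 - c) L).
    { intros c Hc. destruct (H c t1 Hc) as [s [T [E1 [E2 E3]]]].
      apply Rbar_le_trans with (g s); [simpl; lra|].
      apply HE. now exists s, T. }
    destruct L as [r| |]; simpl in *; auto.
    + apply Rnot_lt_le. intros Hr.
      destruct (Rle_lt_dec r 0) as [H0|H0].
      * specialize (Hc (/ 2)). lra.
      * specialize (Hc ((1 - r) / 2)). lra.
    + apply (Hc (/ 2)). lra.
Qed.

Definition loglog (t : R) : R := ln (ln t).
Definition logloglog (t : R) : R := ln (ln (ln t)).

(* The choice of t0 does not affect the limsup, hence the universal quantifier. *)
Definition omega_pair (n : nat) (F sigma : R -> R) : Prop :=
  forall t0 : R, 0 < t0 ->
    Rbar_le 1 (limsup_Sigma sigma t0 (fun s => Cmod (zeta_deriv n s) / F (Im s))).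

(* Main.v *)
(* Resonance method. The Riesz product W(t) = prod_q (1 + cos (t log q)), over K primes q <= 2n
   with (2n)^K <= 2^n, is averaged against the truncated Dirichlet series A(t) of
   zeta^(k)(sigma + it). The mean is taken over differences of two points of an arithmetic
   progression, so that every cosine has nonnegative mean. Since W and A have nonnegative
   cosine coefficients, the mean of W A is at least its diagonal part, about
   prod_q (1 + q^(-sigma) / 2), whereas the mean of W is at most 2 as the logarithms of the
   primes are independent. Hence |zeta^(k)(sigma + it)| is as large as
   exp (c n^(1-sigma) / log n) for some t between 2^(3n) and 2^(13n). For the four functions
   sigma(t), even with eta = 0, this exceeds F(t), because log log t = log n + O(1).

   The derivatives of zeta are handled by differentiating the approximation zeta_approx term
   by term, with bounds that are uniform in the truncation point. *)
From mathcomp Require ssreflect ssrfun ssrbool eqtype ssrnat seq path div prime bigop binomial.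
From Stdlib Require Import Reals Lra Lia List FinFun Classical.
From Coquelicot Require Import Coquelicot.
Require Import Defs.
Open Scope R_scope.

(** * Many primes *)

(** Write Q = 2^n. The obstacle is the pole: the progression of differences contains t near 0, where
    the truncated series is no approximation to the derivative of zeta. Samples with |t| < Q^3 are
    therefore bounded trivially: there W A is at most Q * Q^8 up to logarithms, and these samples
    have a share of about Q^(-10) in the mean. This balance asks for a far end such as Q^13; the
    remainder, of size t N^(-7/8), then asks for a truncation point N of about Q^16.

    The step of the progression is 1/n. The frequencies of W are logarithms of quotients of integers
    at most 2^n, so every phase of W over one step lies in [-1, 1] and there is no aliasing; this is
    where the bound on the product of the primes enters. Distinct integers up to Q have logarithms
    at least 1/Q apart, so a progression of n Q^13 points separates all frequencies of W from 0.

    Each of the K primes, about n / log n in number, multiplies the lower bound by at least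
    exp((2n)^(-sigma) / 4), which gives the exponent n^(1-sigma) / log n up to a constant. *)

Definition prodl (l : list nat) : nat := fold_right Nat.mul 1%nat l.

(* Holds for distinct primes; it makes the products of sublists pairwise distinct. *)
Fixpoint indep (l : list nat) : Prop :=
  match l with
  | nil => True
  | q :: l' => (0 < q)%nat /\ ~ Nat.divide q (prodl l') /\ indep l'
  end.

Section Chebyshev.
Import ssreflect ssrfun ssrbool eqtype ssrnat seq path div prime bigop binomial.
Local Open Scope nat_scope.

Let sum_leq_indicator m L : \sum_(1 <= k < m.+1) (k <= L) <= L.
Proof.
have -> : \sum_(1 <= k < m.+1) (k <= L) = minn m L; last exact: geq_minr.
elim: m => [|m IH]; first by rewrite big_geq // min0n.
rewrite big_nat_recr //= IH /minn; case: (ltngtP m.+1 L) => H.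
- by rewrite addn1.
- by rewrite addn0.
- by rewrite addn1.
Qed.

(** By Legendre's formula the exponent of p is the sum over k of floor(2n/p^k) - 2 floor(n/p^k).
    Each summand is a carry, 0 or 1, and vanishes once p^k > 2n. *)
Let pfactor_central_bin p n : 0 < n -> prime p -> p ^ logn p 'C(n + n, n) <= n + n.
Proof.
move=> n0 pp; have p1 := prime_gt1 pp.
have nn0 : 0 < n + n by rewrite addn_gt0 n0.
apply: leq_trans (trunc_logP p1 nn0).
rewrite leq_exp2l //.
have E := bin_fact (leq_addr n n); rewrite addnK in E.
have {E} : logn p 'C(n + n, n) + (logn p n`! + logn p n`!) = logn p (n + n)`!.
  by rewrite -E !lognM ?muln_gt0 ?fact_gt0 ?bin_gt0 ?leq_addr.
rewrite !logn_fact //.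
(* Terms with k > n vanish because n < p^k, so all Legendre sums may run up to 2n. *)
have -> : \sum_(1 <= k < n.+1) n %/ p ^ k = \sum_(1 <= k < (n + n).+1) n %/ p ^ k.
  rewrite [RHS](@big_cat_nat _ _ _ n.+1) //= ?ltnS ?leq_addr //.
  rewrite [X in _ = _ + X]big_nat_cond [X in _ = _ + X]big1 ?addn0 // => i.
  move=> /andP [/andP [Hi _] _]; apply: divn_small.
  by apply: leq_trans Hi (ltnW (ltn_expl i p1)).
have -> : \sum_(1 <= k < (n + n).+1) (n + n) %/ p ^ k =
   \sum_(1 <= k < (n + n).+1) (p ^ k <= n %% p ^ k + n %% p ^ k) +
   (\sum_(1 <= k < (n + n).+1) n %/ p ^ k + \sum_(1 <= k < (n + n).+1) n %/ p ^ k).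
  rewrite -!big_split /=; apply: eq_bigr => k _.
  by rewrite divnD ?expn_gt0 ?prime_gt0 // addnC.
move=> /addIn ->.
apply: leq_trans (sum_leq_indicator (n + n) _); apply: leq_sum => k _.
case H: (p ^ k <= _) => //=.
rewrite (trunc_log_max p1) //; apply: leq_trans H _.
by rewrite leq_add // leq_mod.
Qed.

Let central_bin_ge n : 2 ^ n <= 'C(n + n, n).
Proof.
elim: n => [|n IH] //.
rewrite addSn addnS binS.
have -> : 'C((n + n).+1, n) = 'C((n + n).+1, n.+1).
  by rewrite -[RHS]bin_sub ?ltnS ?leq_addr // subSS addnK.
rewrite expnS mul2n -addnn leq_add //; apply: (leq_trans IH); rewrite binS leq_addl //.
Qed.

Let prime_indep l : uniq l -> all prime l -> indep l.
Proof.
elim: l => [|q l IH] //= /andP [ql ul] /andP [pq pl]; split; last split; last exact: IH.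
  exact/ltP/prime_gt0.
move=> [z E]; move: ql; apply/negP; rewrite negbK.
have : q %| prodl l by apply/dvdnP; exists z.
elim: l pl {ul IH E} => [|r l IH] /=; first by rewrite dvdn1 => _ /eqP E; move: pq; rewrite E.
move=> /andP [pr pl].
rewrite (Euclid_dvdM r (prodl l) pq) => /orP [|/(IH pl) H].
  by rewrite (dvdn_prime2 pq pr) => /eqP ->; rewrite in_cons eqxx.
by rewrite in_cons H orbT.
Qed.

Let prime_factors_bound n : 0 < n -> 2 ^ n <= (n + n) ^ size (primes 'C(n + n, n)).
Proof.
move=> n0; apply: leq_trans (central_bin_ge n) _.
have C0 : 0 < 'C(n + n, n) by rewrite bin_gt0 leq_addr.
rewrite {1}(prod_prime_decomp C0) prime_decompE big_map /=.
have : all prime (primes 'C(n + n, n)) by apply/allP => p; rewrite mem_primes => /andP [].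
elim: (primes _) => [|p l IH] /=; first by rewrite big_nil.
by move=> /andP [pp /IH H]; rewrite big_cons expnS leq_mul // pfactor_central_bin.
Qed.

(* Erdos: every prime power in the factorization of [C(2n,n) >= 2^n] is at most [2n]. *)
Lemma many_primes (n : nat) : (1 <= n)%coq_nat -> exists qs : list nat,
  indep qs /\ (forall q, In q qs -> (1 <= q)%coq_nat /\ (q <= Nat.mul 2 n)%coq_nat) /\
  (Nat.pow (Nat.mul 2 n) (length qs) <= Nat.pow 2 n)%coq_nat /\
  (Nat.pow 2 n < Nat.pow (Nat.mul 2 n) (S (length qs)))%coq_nat.
Proof.
move=> /leP n0.
have n1 : 1 < n + n by rewrite -(addn1 1) leq_add.
(* K is the largest exponent with (2n)^K <= 2^n. There are at least K prime factors and only K are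
   kept: this bounds their product by 2^n, while the maximality of K keeps their number of order n /
   log n. *)
set ps := primes 'C(n + n, n); set K := trunc_log (n + n) (2 ^ n).
have Kle : K <= size ps.
  have H : (n + n) ^ K <= (n + n) ^ size ps.
    by apply: leq_trans (prime_factors_bound n n0); apply: trunc_logP; rewrite ?expn_gt0.
  by rewrite leq_exp2l in H.
have sub p : p \in take K ps -> prime p /\ p <= n + n.
  move=> /mem_take; rewrite mem_primes => /and3P [pp C0 pC]; split=> //.
  have : p <= p ^ logn p 'C(n + n, n).
    by rewrite -{1}(expn1 p) leq_exp2l ?prime_gt1 // -pfactor_dvdn.
  by move=> H; exact: (leq_trans H (pfactor_central_bin p n n0 pp)).
have powE a b : Nat.pow a b = a ^ b.
  by elim: b => [|b IH] //=; rewrite expnS IH.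
have dE : (2 * n)%coq_nat = n + n by rewrite /= -plus_n_O.
have sK : length (take K ps) = K by exact: (size_takel Kle).
exists (take K ps); rewrite sK dE !powE; split; last split; last split.
- apply: prime_indep; first by rewrite take_uniq // primes_uniq.
  by apply/allP => p /sub [].
- move=> q qin; have /sub [pq qn] : q \in take K ps.
    elim: (take K ps) qin => [|r l IH] //= [->|/IH H]; rewrite in_cons ?eqxx // H orbT //.
  split; apply/leP; [exact: prime_gt0 | by []].
- have H : 0 < 2 ^ n by rewrite expn_gt0.
  by apply/leP; exact: trunc_logP n1 H.
- by apply/ltP; exact: trunc_log_ltn n1.
Qed.
End Chebyshev.

(** * Approximations of the derivatives of zeta *)

Lemma dC_ext (p q : R -> C) d x : (forall u, p u = q u) -> Defs.dC p d x -> Defs.dC q d x.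
Proof.
  intros H [H1 H2]; split; eapply is_derive_ext; try eassumption;
    intros u; simpl; now rewrite H.
Qed.

Lemma dC_prod (p q : R -> C) (d e : C) x : Defs.dC p d x -> Defs.dC q e x ->
  Defs.dC (fun u => p u * q u)%C (d * q x + p x * e)%C x.
Proof.
  intros [H1 H2] [H3 H4].
  assert (M : forall f g f' g', is_derive f x f' -> is_derive g x g' ->
    is_derive (fun u : R => f u * g u : R) x (f' * g x + f x * g')).
  { intros f g f' g' Hf Hg.
    apply (is_derive_mult f g x f' g'); auto. intros; apply Rmult_comm. }
  split; simpl.
  - replace (_ + _) with ((Re d * Re (q x) + Re (p x) * Re e)
      - (Im d * Im (q x) + Im (p x) * Im e)) by (unfold Re, Im; ring).
    apply (is_derive_minus (fun u => Re (p u) * Re (q u)) (fun u => Im (p u) * Im (q u)));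
      now apply M.
  - replace (_ + _) with ((Re d * Im (q x) + Re (p x) * Im e)
      + (Im d * Re (q x) + Im (p x) * Re e)) by (unfold Re, Im; ring).
    apply (is_derive_plus (fun u => Re (p u) * Im (q u)) (fun u => Im (p u) * Re (q u)));
      now apply M.
Qed.

Lemma dC_inv (a b : C) x : (a + b * RtoC x)%C <> 0%C ->
  Defs.dC (fun u => / (a + b * RtoC u))%C
    (- b / ((a + b * RtoC x) * (a + b * RtoC x)))%C x.
Proof.
  intros H. destruct a as [a1 a2], b as [b1 b2].
  set (P := a1 + b1 * x). set (Q := a2 + b2 * x).
  assert (HPQ : P * P + Q * Q <> 0).
  { intros E. apply H. assert (P = 0) by nra. assert (Q = 0) by nra.
    apply Defs.Ceq; simpl; unfold P, Q in *; lra. }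
  assert (E : forall u, Re (/ ((a1, a2) + (b1, b2) * RtoC u))%C
     = (a1 + b1 * u) / ((a1 + b1 * u) * (a1 + b1 * u) + (a2 + b2 * u) * (a2 + b2 * u))).
  { intros u. simpl. unfold Rdiv. f_equal; [ring|f_equal; ring]. }
  assert (E' : forall u, Im (/ ((a1, a2) + (b1, b2) * RtoC u))%C
     = - (a2 + b2 * u) / ((a1 + b1 * u) * (a1 + b1 * u) + (a2 + b2 * u) * (a2 + b2 * u))).
  { intros u. simpl. unfold Rdiv. f_equal; [ring|f_equal; ring]. }
  assert (HPQ' : (P * P - Q * Q) ^ 2 + (2 * P * Q) ^ 2 <> 0).
  { replace (_ + _) with ((P * P + Q * Q) ^ 2) by ring. now apply pow_nonzero. }
  replace (((a1, a2) + (b1, b2) * RtoC x) * ((a1, a2) + (b1, b2) * RtoC x))%C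
    with ((P * P - Q * Q, 2 * P * Q) : C) by (apply Defs.Ceq; simpl; unfold P, Q; ring).
  split.
  - eapply is_derive_ext; [intros u; symmetry; apply E|].
    auto_derive; [exact HPQ|]. fold P Q. simpl. field. split; auto.
    intros Hz; apply HPQ'; rewrite <- Hz; ring.
  - eapply is_derive_ext; [intros u; symmetry; apply E'|].
    auto_derive; [exact HPQ|]. fold P Q. simpl. field. split; auto.
    intros Hz; apply HPQ'; rewrite <- Hz; ring.
Qed.

(* An antiderivative in [x] of [(- ln x)^k x^(-s)], from k-fold integration by parts. *)
Fixpoint prim (k : nat) (s : C) (x : R) : C :=
  match k with
  | O => (Cpow x (1 - s) / (1 - s))%C
  | S j => ((RtoC ((- ln x) ^ S j) * Cpow x (1 - s) + RtoC (INR (S j)) * prim j s x)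
             / (1 - s))%C
  end.

(** The k-th derivative in [s] of [zeta_approx s N]: m^(-s) becomes (- log m)^k m^(-s), and [prim]
    passes to the next [prim] under differentiation in [s]. *)
Definition zapprox (k : nat) (s : C) (N : nat) : C :=
  (sum_n (fun m => RtoC ((- ln (INR (S m))) ^ k) * Cpow (INR (S m)) (- s))%C N
   - prim k s (INR (S N)))%C.

Lemma zapprox_0 s N : zapprox 0 s N = zeta_approx s N.
Proof.
  unfold zapprox, zeta_approx. simpl prim. f_equal.
  apply sum_n_ext. intros m. simpl. apply Cmult_1_l.
Qed.

Lemma Cpow_neg_pred x s : 0 < x -> Cpow x (- s) = (Cpow x (1 - s) * RtoC (/ x))%C.
Proof. intros Hx. rewrite <- Defs.Cpow_pred by auto. f_equal. ring. Qed.

Lemma is_derive_neg_ln_pow k x : 0 < x ->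
  is_derive (fun u => (- ln u) ^ k) x (- (INR k * (- ln x) ^ pred k * / x)).
Proof. intros Hx. auto_derive; [auto|]. field. lra. Qed.

Lemma dC_prim_x k s x : (1 - s)%C <> 0%C -> 0 < x ->
  Defs.dC (fun u => prim k s u) (RtoC ((- ln x) ^ k) * Cpow x (- s))%C x.
Proof.
  intros Hs Hx. induction k as [|k IH].
  - simpl. rewrite Cmult_1_l. replace (- s)%C with (1 - s - 1)%C by ring. now apply Defs.dC_P.
  - apply dC_ext with (fun u => / (1 - s) *
      (RtoC ((- ln u) ^ S k) * Cpow u (1 - s) + RtoC (INR (S k)) * prim k s u))%C.
    { intros u. cbn [prim]. unfold Cdiv. ring. }
    eapply Defs.dC_eq.
    2: { apply Defs.dC_mult, Defs.dC_plus.
      - apply (Defs.dC_scal (fun u => (- ln u) ^ S k)); [now apply is_derive_neg_ln_pow|].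
        now apply Defs.dC_Cpow.
      - apply Defs.dC_mult. exact IH. }
    rewrite Defs.Cpow_pred, (Cpow_neg_pred x s) by auto.
    cbn [pred]. rewrite RtoC_opp, !RtoC_mult. field. auto.
Qed.

(** Complex differentiation in [s] is reduced to real calculus: [s] moves along the line s + h v
    with real v, so every derivative carries a factor [h]. *)
Lemma dC_Cpow_line x s h u : 0 < x ->
  Defs.dC (fun v => Cpow x (1 - (s + h * RtoC v)))%C
     (h * RtoC (- ln x) * Cpow x (1 - (s + h * RtoC u)))%C u.
Proof.
  intros Hx.
  assert (E : forall v, Cpow x (1 - (s + h * RtoC v)) =
     (Cpow x (1 - s) * Cexp (h * RtoC (- ln x) * RtoC v))%C).
  { intros v. unfold Cpow. rewrite <- Defs.Cexp_plus. f_equal. rewrite RtoC_opp. ring. }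
  eapply dC_ext; [intros v; symmetry; apply E|].
  rewrite E.
  eapply Defs.dC_eq.
  2: { apply Defs.dC_mult, (Defs.dC_Cexp (h * RtoC (- ln x))%C (fun v => v)).
       apply @is_derive_id. }
  change (one : R) with 1. change (RtoC one) with (RtoC 1). ring.
Qed.

(** Differentiating (1 - s) prim 0 = x^(1-s) repeatedly in [s] gives, by Leibniz's rule, exactly the
    recursion that defines [prim]. So one formula is both an antiderivative in [x] and an iterated
    derivative in [s]. *)
Lemma dC_prim_s k s h x u : (1 - (s + h * RtoC u))%C <> 0%C -> 0 < x ->
  Defs.dC (fun v => prim k (s + h * RtoC v)%C x) (h * prim (S k) (s + h * RtoC u)%C x)%C u.
Proof.
  intros Hs Hx.
  assert (Hi : Defs.dC (fun v => / (1 - (s + h * RtoC v)))%C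
     (h / ((1 - (s + h * RtoC u)) * (1 - (s + h * RtoC u))))%C u).
  { assert (E : forall v, (1 - s + - h * RtoC v)%C = (1 - (s + h * RtoC v))%C)
      by (intros; ring).
    apply dC_ext with (fun v => / (1 - s + - h * RtoC v))%C; [intros v; now rewrite E|].
    eapply Defs.dC_eq; [|apply dC_inv; now rewrite E].
    rewrite E. field. auto. }
  assert (Hp := dC_Cpow_line x s h u Hx).
  induction k as [|k IH].
  - eapply Defs.dC_eq; [|apply dC_prod; [exact Hp|exact Hi]].
    simpl. rewrite Rmult_1_r. field. auto.
  - change (fun v : R => prim (S k) (s + h * RtoC v) x)%C with
     (fun v : R => ((RtoC ((- ln x) ^ S k) * Cpow x (1 - (s + h * RtoC v))
        + RtoC (INR (S k)) * prim k (s + h * RtoC v) x) * / (1 - (s + h * RtoC v))))%C.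
    eapply Defs.dC_eq.
    2: { apply dC_prod; [|exact Hi].
         apply Defs.dC_plus; apply Defs.dC_mult; [exact Hp|exact IH]. }
    cbv beta. set (W := (1 - (s + h * RtoC u))%C) in *.
    set (p := prim k (s + h * RtoC u) x).
    set (X := Cpow x W).
    assert (E1 : prim (S k) (s + h * RtoC u) x =
      ((RtoC ((- ln x) ^ S k) * X + RtoC (INR (S k)) * p) / W)%C) by reflexivity.
    change (prim (S (S k)) (s + h * RtoC u) x) with
      ((RtoC ((- ln x) ^ S (S k)) * X + RtoC (INR (S (S k))) * prim (S k) (s + h * RtoC u) x) / W)%C.
    rewrite E1. rewrite (S_INR (S k)), RtoC_plus.
    change ((- ln x) ^ S (S k)) with ((- ln x) * (- ln x) ^ S k). rewrite RtoC_mult.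
    field. auto.
Qed.

Lemma dC_zapprox k s h N u : (1 - (s + h * RtoC u))%C <> 0%C ->
  Defs.dC (fun v => zapprox k (s + h * RtoC v)%C N) (h * zapprox (S k) (s + h * RtoC u)%C N)%C u.
Proof.
  intros Hs.
  assert (HT : forall m, Defs.dC
     (fun v => RtoC ((- ln (INR (S m))) ^ k) * Cpow (INR (S m)) (- (s + h * RtoC v)))%C
     (h * (RtoC ((- ln (INR (S m))) ^ S k) * Cpow (INR (S m)) (- (s + h * RtoC u))))%C u).
  { intros m. assert (Hm := Defs.INR_S_pos m). set (x := INR (S m)) in *.
    apply Defs.dC_eq with (RtoC ((- ln x) ^ k) *
       (h * RtoC (- ln x) * Cpow x (- (s + h * RtoC u))))%C.
    { simpl pow. rewrite RtoC_mult. ring. }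
    apply Defs.dC_mult.
    assert (E : forall v, (- (s + h * RtoC v))%C = (1 - ((s + 1) + h * RtoC v))%C)
      by (intros; ring).
    rewrite E. apply dC_ext with (fun v => Cpow x (1 - ((s + 1) + h * RtoC v)));
      [intros v; now rewrite E|].
    apply dC_Cpow_line. lra. }
  assert (HS : Defs.dC (fun v => sum_n (fun m => RtoC ((- ln (INR (S m))) ^ k) *
         Cpow (INR (S m)) (- (s + h * RtoC v)))%C N)
      (h * sum_n (fun m => RtoC ((- ln (INR (S m))) ^ S k) *
         Cpow (INR (S m)) (- (s + h * RtoC u)))%C N)%C u).
  { induction N as [|N IH].
    - rewrite sum_O. eapply dC_ext; [|exact (HT O)]. intros v; now rewrite sum_O.
    - rewrite sum_Sn. change (plus ?x ?y) with (x + y)%C. rewrite Cmult_plus_distr_l.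
      eapply dC_ext; [|exact (Defs.dC_plus _ _ _ _ _ IH (HT (S N)))].
      intros v; now rewrite sum_Sn. }
  assert (Hx : 0 < INR (S N)) by (assert (H := Defs.INR_S_pos N); lra).
  eapply dC_ext; [|eapply Defs.dC_eq;
    [|exact (Defs.dC_plus _ _ _ _ _ HS (Defs.dC_mult (-1) _ _ _ (dC_prim_s k s h _ u Hs Hx)))]].
  - intros v. unfold zapprox. simpl. ring.
  - unfold zapprox. simpl. ring.
Qed.

(** * Bounds uniform in the truncation point, and the passage to the limit *)

Lemma ln2_le_1 : ln 2 <= 1.
Proof. rewrite <- (ln_exp 1). apply ln_le; [lra|]. assert (T := exp_ineq1_le 1). lra. Qed.

Lemma exp_monotone x y : x <= y -> exp x <= exp y.
Proof. intros [H|H]; [left; now apply exp_increasing|right; now rewrite H]. Qed.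

Lemma ln_ge0 x : 1 <= x -> 0 <= ln x.
Proof. intros H. rewrite <- ln_1. apply ln_le; lra. Qed.

Lemma ln_pow_bound k c : 0 < c ->
  exists B, 0 <= B /\ forall x, 1 <= x -> (1 + ln x) ^ k <= B * Rpower x c.
Proof.
  revert c. induction k as [|k IH]; intros c Hc.
  - exists 1. split; [lra|]. intros x Hx. simpl. rewrite Rmult_1_l.
    rewrite <- (Rpower_O x) by lra. apply Rle_Rpower; lra.
  - destruct (IH (c / 2)) as [B [HB H]]; [lra|].
    assert (Hi : 0 < / (c / 2)) by (apply Rinv_0_lt_compat; lra).
    exists ((1 + / (c / 2)) * B). split; [apply Rmult_le_pos; lra|].
    intros x Hx. specialize (H x Hx).
    destruct (Defs.ln_le_Rpower x (c / 2)) as [H0 H1]; [lra|auto|].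
    assert (H2 : 1 <= Rpower x (c / 2)).
    { rewrite <- (Rpower_O x) by lra. apply Rle_Rpower; lra. }
    replace (Rpower x c) with (Rpower x (c / 2) * Rpower x (c / 2))
      by (rewrite <- Rpower_plus; f_equal; lra).
    simpl pow.
    replace ((1 + / (c / 2)) * B * (Rpower x (c / 2) * Rpower x (c / 2))) with
      (((1 + / (c / 2)) * Rpower x (c / 2)) * (B * Rpower x (c / 2))) by ring.
    apply Rmult_le_compat; try lra. apply pow_le; lra.
Qed.

Lemma neg_ln_pow_le k x : 1 <= x -> Rabs ((- ln x) ^ k) <= (1 + ln x) ^ k.
Proof.
  intros Hx. assert (H := ln_ge0 x Hx).
  rewrite <- RPow_abs, Rabs_Ropp, Rabs_pos_eq by auto. apply pow_incr; lra.
Qed.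

Lemma zapprox_S k s N : zapprox k s (S N) = (zapprox k s N +
  (RtoC ((- ln (INR (S (S N)))) ^ k) * Cpow (INR (S (S N))) (- s)
   - (prim k s (INR (S (S N))) - prim k s (INR (S N)))))%C.
Proof.
  unfold zapprox. rewrite sum_Sn. change (plus ?x ?y) with (x + y)%C. ring.
Qed.

(** The increment is the value of a function at the end of a unit interval minus its integral there,
    so the derivative of the function controls it. Giving up [c] in the exponent absorbs the power
    of the logarithm and makes [B] independent of [s]. *)
Lemma zapprox_step k c : 0 < c -> exists B, 0 <= B /\ forall s, (1 - s)%C <> 0%C -> c <= Re s ->
  forall N, Cmod (zapprox k s (S N) - zapprox k s N)%C
    <= B * (1 + Cmod s) * Rpower (INR (S N)) (-1 - (Re s - c)).
Proof.
  intros Hc. destruct (ln_pow_bound k c Hc) as [B [HB HL]].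
  assert (Hk := pos_INR k).
  exists (4 * ((INR k + 1) * B)). split.
  { apply Rmult_le_pos; [lra|]. apply Rmult_le_pos; lra. }
  intros s Hs Hsc N. rewrite zapprox_S.
  assert (HN := Defs.INR_S_pos N).
  match goal with |- Cmod (?u + ?d - ?u)%C <= _ => replace (u + d - u)%C with d by ring end.
  rewrite !(Rmult_assoc 4).
  apply (Defs.unit_step (prim k s) (fun u => RtoC ((- ln u) ^ k) * Cpow u (- s))%C
    (fun u => RtoC (- (INR k * (- ln u) ^ pred k * / u)) * Cpow u (- s)
        + RtoC ((- ln u) ^ k) * (- s * Cpow u (- s - 1)))%C (INR (S N))).
  - now rewrite (S_INR (S N)).
  - intros x Hx. apply dC_prim_x; auto; lra.
  - intros x Hx. apply (Defs.dC_scal (fun u => (- ln u) ^ k)).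
    + apply is_derive_neg_ln_pow; lra.
    + apply Defs.dC_Cpow; lra.
  - intros x [Hx _]. assert (Hx1 : 1 <= x) by lra. assert (HL0 := ln_ge0 x Hx1).
    assert (Hs0 := Cmod_ge_0 s).
    assert (EY : Rpower x (-1 - Re s) = / x * Rpower x (- Re s)).
    { replace (-1 - Re s) with (- (1) + - Re s) by ring.
      rewrite Rpower_plus, Rpower_Ropp, Rpower_1 by lra. reflexivity. }
    eapply Rle_trans; [apply Cmod_triangle|].
    rewrite !Cmod_mult, !Cmod_R, Cmod_opp, !Defs.Cmod_Cpow.
    replace (Re (- s - 1)%C) with (-1 - Re s) by (destruct s; simpl; ring).
    change (Re (- s)%C) with (- Re s).
    set (Y := Rpower x (-1 - Re s)) in *. assert (HY : 0 < Y) by apply exp_pos.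
    assert (A1 : Rabs ((- ln x) ^ k) <= (1 + ln x) ^ k) by now apply neg_ln_pow_le.
    assert (A2 : Rabs ((- ln x) ^ pred k) <= (1 + ln x) ^ k).
    { eapply Rle_trans; [now apply neg_ln_pow_le|]. apply Rle_pow; [lra|lia]. }
    assert (A0 : 0 <= (1 + ln x) ^ k) by (apply pow_le; lra).
    assert (T1 : Rabs (- (INR k * (- ln x) ^ pred k * / x)) * Rpower x (- Re s)
       <= INR k * (1 + ln x) ^ k * Y).
    { rewrite Rabs_Ropp, !Rabs_mult, (Rabs_pos_eq (INR k)) by auto.
      rewrite (Rabs_pos_eq (/ x)) by (left; apply Rinv_0_lt_compat; lra).
      rewrite Rmult_assoc, <- EY. apply Rmult_le_compat_r; [lra|].
      apply Rmult_le_compat_l; auto. }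
    assert (T2 : Rabs ((- ln x) ^ k) * (Cmod s * Y) <= (1 + ln x) ^ k * (Cmod s * Y)).
    { apply Rmult_le_compat_r; auto. apply Rmult_le_pos; lra. }
    apply Rle_trans with ((INR k + 1) * (1 + Cmod s) * ((1 + ln x) ^ k * Y)).
    { assert (0 <= (1 + ln x) ^ k * Y) by (apply Rmult_le_pos; lra).
      assert (0 <= INR k * Cmod s) by now apply Rmult_le_pos. nra. }
    apply Rle_trans with ((INR k + 1) * (1 + Cmod s) * (B * Rpower x c * Y)).
    { apply Rmult_le_compat_l; [apply Rmult_le_pos; lra|].
      apply Rmult_le_compat_r; [lra|]. now apply HL. }
    replace ((INR k + 1) * (1 + Cmod s) * (B * Rpower x c * Y)) with
      ((INR k + 1) * B * (1 + Cmod s) * (Rpower x c * Y)) by ring.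
    apply Rmult_le_compat_l; [apply Rmult_le_pos; [apply Rmult_le_pos|]; lra|].
    unfold Y. rewrite <- Rpower_plus.
    replace (c + (-1 - Re s)) with (-1 - (Re s - c)) by ring.
    apply Defs.Rpower_neg_le; lra.
Qed.

(* Dominates the tail [sum_(i >= N) (i+1)^(-1-c)]. *)
Definition tailw (c : R) (N : nat) : R :=
  match N with O => 1 + / c | S _ => / c * Rpower (INR N) (- c) end.

Lemma tailw_pos c N : 0 < c -> 0 < tailw c N.
Proof.
  intros Hc. assert (Hi := Rinv_0_lt_compat c Hc).
  destruct N; unfold tailw; [lra|]. apply Rmult_lt_0_compat; auto. apply exp_pos.
Qed.

Lemma tailw_step c N : 0 < c ->
  Rpower (INR (S N)) (-1 - c) <= tailw c N - tailw c (S N).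
Proof.
  intros Hc. destruct N as [|N]; unfold tailw.
  - assert (E : forall y, Rpower (INR 1) y = 1).
    { intros y. unfold Rpower. simpl. now rewrite ln_1, Rmult_0_r, exp_0. }
    rewrite !E. lra.
  - assert (HN := Defs.INR_S_pos N). assert (HS := S_INR (S N)).
    destruct (Defs.mvt_R (fun x => Rpower x (- c)) (fun x => - c * Rpower x (- c - 1))
                (INR (S N)) (INR (S (S N)))) as [x [Hx E]]; [lra| |].
    { intros x Hx. apply is_derive_Reals, derivable_pt_lim_power. lra. }
    replace (INR (S (S N)) - INR (S N)) with 1 in E by lra.
    rewrite <- Rmult_minus_distr_l.
    replace (Rpower _ (- c) - Rpower _ (- c)) with (c * Rpower x (- c - 1)) by lra.
    rewrite <- Rmult_assoc, Rinv_l, Rmult_1_l by lra.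
    replace (- c - 1) with (-1 - c) by ring.
    apply Defs.Rpower_neg_le; lra.
Qed.

Lemma telescope_bound (a : nat -> C) b c : 0 < c -> 0 <= b ->
  (forall N, Cmod (a (S N) - a N)%C <= b * Rpower (INR (S N)) (-1 - c)) ->
  forall N M, Cmod (a (N + M)%nat - a N)%C <= b * tailw c N.
Proof.
  intros Hc Hb H N M.
  apply Rle_trans with (b * (tailw c N - tailw c (N + M))).
  - induction M as [|M IH].
    + rewrite Nat.add_0_r. replace (a N - a N)%C with (RtoC 0) by ring. rewrite Cmod_0.
      right; ring.
    + rewrite Nat.add_succ_r.
      replace (a (S (N + M)) - a N)%C with
        ((a (S (N + M)) - a (N + M)%nat) + (a (N + M)%nat - a N))%C by ring.
      eapply Rle_trans; [apply Cmod_triangle|].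
      assert (H1 := H (N + M)%nat). assert (H2 := tailw_step c (N + M) Hc).
      apply (Rmult_le_compat_l b) in H2; auto.
      lra.
  - apply Rmult_le_compat_l; auto. assert (T := tailw_pos c (N + M) Hc). lra.
Qed.

Lemma clim_Cmod_le (a : nat -> C) l B :
  Defs.clim a l -> (forall N, Cmod (a N) <= B) -> Cmod l <= 2 * B.
Proof.
  intros [H1 H2] H.
  assert (HB : forall (u : nat -> R) (x : R), is_lim_seq u x -> (forall N, Rabs (u N) <= B) ->
     Rabs x <= B).
  { intros u x Hu Hub. apply is_lim_seq_abs in Hu. simpl in Hu.
    apply (is_lim_seq_le _ _ (Rabs x) B Hub Hu (is_lim_seq_const B)). }
  eapply Rle_trans; [apply Defs.Cmod_le_abs|].
  assert (Rabs (Re l) <= B).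
  { eapply HB; [exact H1|]. intros N. eapply Rle_trans; [apply Defs.Re_le_Cmod|auto]. }
  assert (Rabs (Im l) <= B).
  { eapply HB; [exact H2|]. intros N. eapply Rle_trans; [apply Defs.Im_le_Cmod|auto]. }
  lra.
Qed.

Lemma clim_shift (a : nat -> C) l N : Defs.clim a l -> Defs.clim (fun M => a (N + M)%nat) l.
Proof.
  intros [H1 H2]; split.
  - apply (is_lim_seq_incr_n _ N) in H1. eapply is_lim_seq_ext; [|exact H1].
    intros M; simpl; now rewrite Nat.add_comm.
  - apply (is_lim_seq_incr_n _ N) in H2. eapply is_lim_seq_ext; [|exact H2].
    intros M; simpl; now rewrite Nat.add_comm.
Qed.

Lemma clim_const (z : C) : Defs.clim (fun _ => z) z.
Proof. split; apply is_lim_seq_const. Qed.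

Lemma zapprox_cvg k s : 0 < Re s -> (1 - s)%C <> 0%C -> exists l, Defs.clim (zapprox k s) l.
Proof.
  intros Hs Hs1.
  destruct (zapprox_step k (Re s / 2)) as [B [HB H]]; [lra|].
  destruct (Defs.seq_conv_C (zapprox k s)
     (fun N => B * (1 + Cmod s) * Rpower (INR (S N)) (-1 - (Re s - Re s / 2)))) as [l [Hl _]].
  - intros N. apply H; auto; lra.
  - apply (@ex_series_scal R_AbsRing R_NormedModule). apply Defs.p_series. lra.
  - now exists l.
Qed.

(** The dependence on [s] is explicit and grows only linearly in |s|, so truncating at a suitable
    fixed power of the height makes the error negligible. *)
Lemma zapprox_tail k c : 0 < c -> exists B, 0 <= B /\ forall s, (1 - s)%C <> 0%C -> c < Re s ->
  (forall N M, Cmod (zapprox k s (N + M) - zapprox k s N)%C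
     <= B * (1 + Cmod s) * tailw (Re s - c) N) /\
  forall l, Defs.clim (zapprox k s) l -> forall N,
    Cmod (l - zapprox k s N)%C <= 2 * (B * (1 + Cmod s) * tailw (Re s - c) N).
Proof.
  intros Hc. destruct (zapprox_step k c Hc) as [B [HB H]].
  exists B; split; auto. intros s Hs Hsc.
  assert (Hs0 := Cmod_ge_0 s).
  assert (T : forall N M, Cmod (zapprox k s (N + M) - zapprox k s N)%C
     <= B * (1 + Cmod s) * tailw (Re s - c) N).
  { apply telescope_bound; [lra|apply Rmult_le_pos; lra|]. intros N. apply H; auto; lra. }
  split; auto. intros l Hl N.
  apply clim_Cmod_le with (fun M => zapprox k s (N + M) + - zapprox k s N)%C; [|exact (T N)].
  apply Defs.clim_plus; [now apply clim_shift|apply clim_const].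
Qed.

Fixpoint primw (k : nat) (r : R) : R :=
  match k with O => 1 | S j => 1 + INR (S j) * primw j r / r end.

Lemma primw_pos k r : 0 < r -> 1 <= primw k r.
Proof.
  intros Hr. induction k as [|k IH]; cbn [primw]; [lra|].
  assert (0 <= INR (S k) * primw k r / r); [|lra].
  apply Rdiv_le_0_compat; auto. apply Rmult_le_pos; [apply pos_INR|lra].
Qed.

(** Unfolding the recursion of [prim], the inner divisions by 1 - s are bounded through [r] and
    collected in [primw]; the outermost is kept, since it supplies a decay 1/t at height t. *)
Lemma prim_bound k r s x : 0 < r -> r <= Cmod (1 - s)%C -> 1 <= x ->
  Cmod (prim k s x) <= primw k r * (1 + ln x) ^ k * Rpower x (1 - Re s) / Cmod (1 - s)%C.
Proof.
  intros Hr Hs Hx. assert (HL := ln_ge0 x Hx).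
  set (W := Cmod (1 - s)%C) in *. assert (HW : 0 < W) by lra.
  assert (Hs1 : (1 - s)%C <> 0%C) by now apply Cmod_gt_0.
  assert (EX : Cmod (Cpow x (1 - s)) = Rpower x (1 - Re s)) by apply Defs.Cmod_Cpow.
  set (X := Rpower x (1 - Re s)) in *. assert (HX : 0 < X) by apply exp_pos.
  induction k as [|k IH]; cbn [prim primw].
  - rewrite Cmod_div by auto. rewrite EX. simpl. fold W. right. field. lra.
  - rewrite Cmod_div by auto. fold W. unfold Rdiv at 2.
    apply Rmult_le_compat_r; [left; now apply Rinv_0_lt_compat|].
    eapply Rle_trans; [apply Cmod_triangle|].
    rewrite !Cmod_mult, !Cmod_R, EX.
    set (P := primw k r) in *. assert (HP : 1 <= P) by now apply primw_pos.
    assert (A0 : 0 <= (1 + ln x) ^ k) by (apply pow_le; lra).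
    assert (A1 : Rabs ((- ln x) ^ S k) <= (1 + ln x) ^ S k) by now apply neg_ln_pow_le.
    rewrite (Rabs_pos_eq (INR (S k))) by apply pos_INR.
    assert (A2 : Cmod (prim k s x) <= P / r * (1 + ln x) ^ S k * X).
    { eapply Rle_trans; [exact IH|].
      replace (P * (1 + ln x) ^ k * X / W) with ((P * (1 + ln x) ^ k * X) * / W) by reflexivity.
      replace (P / r * (1 + ln x) ^ S k * X) with ((P * (1 + ln x) ^ S k * X) * / r)
        by (field; lra).
      apply Rmult_le_compat.
      - apply Rmult_le_pos; [apply Rmult_le_pos|]; lra.
      - left; now apply Rinv_0_lt_compat.
      - apply Rmult_le_compat_r; [lra|]. apply Rmult_le_compat_l; [lra|].
        apply Rle_pow; [lra|lia].
      - now apply Rinv_le_contravar. }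
    apply (Rmult_le_compat_l (INR (S k))) in A2; [|apply pos_INR].
    apply (Rmult_le_compat_r X) in A1; [|lra].
    replace ((1 + INR (S k) * P / r) * (1 + ln x) ^ S k * X) with
      ((1 + ln x) ^ S k * X + INR (S k) * (P / r * (1 + ln x) ^ S k * X)) by (field; lra).
    lra.
Qed.

(** On the disc of radius min(Re s / 4, |1 - s| / 2) both Re and the distance to the pole stay
    bounded below. The tail estimate from index 0 then bounds all truncations at once. *)
Lemma zapprox_locally_bounded k s : 0 < Re s -> (1 - s)%C <> 0%C ->
  exists K d, 0 < d /\ 0 <= K /\ forall h, Cmod h <= d ->
    0 < Re (s + h)%C /\ (1 - (s + h))%C <> 0%C /\ forall N, Cmod (zapprox k (s + h) N) <= K.
Proof.
  intros Hs Hs1. assert (HW := proj1 (Cmod_gt_0 _) Hs1). set (W := Cmod (1 - s)%C) in *.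
  set (c := Re s / 4). assert (Hc : 0 < c) by (unfold c; lra).
  destruct (zapprox_tail k c Hc) as [B [HB H]].
  assert (HP := primw_pos k (W / 2)). specialize (HP ltac:(lra)).
  assert (Hi : 0 < / c) by now apply Rinv_0_lt_compat.
  assert (HPW : 0 <= primw k (W / 2) / (W / 2)) by (apply Rdiv_le_0_compat; lra).
  assert (Hs0 := Cmod_ge_0 s).
  exists (1 + primw k (W / 2) / (W / 2) + B * (1 + (Cmod s + c)) * (1 + / c)), (Rmin c (W / 2)).
  split; [apply Rmin_glb_lt; lra|]. split.
  { assert (0 <= B * (1 + (Cmod s + c)) * (1 + / c)); [|lra].
    apply Rmult_le_pos; [apply Rmult_le_pos|]; lra. }
  intros h Hh.
  assert (Hh1 : Cmod h <= c) by (eapply Rle_trans; [apply Hh|apply Rmin_l]).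
  assert (Hh2 : Cmod h <= W / 2) by (eapply Rle_trans; [apply Hh|apply Rmin_r]).
  assert (Hre : 3 * c <= Re (s + h)%C).
  { assert (HR := Defs.Re_le_Cmod h). apply Rabs_le_between in HR.
    change (Re (s + h)%C) with (Re s + Re h). unfold c in *. lra. }
  assert (HW2 : W / 2 <= Cmod (1 - (s + h))%C).
  { assert (W <= Cmod (1 - (s + h))%C + Cmod h); [|lra].
    unfold W. replace (1 - s)%C with (1 - (s + h) + h)%C by ring. apply Cmod_triangle. }
  assert (Hne : (1 - (s + h))%C <> 0%C) by (apply Cmod_gt_0; lra).
  split; [lra|]. split; auto. intros N.
  destruct (H (s + h)%C Hne) as [H1 _]; [lra|].
  specialize (H1 O N). simpl Nat.add in H1.
  replace (zapprox k (s + h) N) with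
    (zapprox k (s + h) 0 + (zapprox k (s + h) N - zapprox k (s + h) 0))%C by ring.
  eapply Rle_trans; [apply Cmod_triangle|]. apply Rplus_le_compat.
  - unfold zapprox. rewrite sum_O. eapply Rle_trans; [apply Cmod_triangle|].
    rewrite Cmod_opp, Cmod_mult, Cmod_R, Defs.Cpow_1, Cmod_1.
    apply Rplus_le_compat.
    + rewrite Rmult_1_r. eapply Rle_trans; [apply neg_ln_pow_le; simpl; lra|].
      simpl INR. rewrite ln_1, Rplus_0_r, pow1. lra.
    + eapply Rle_trans; [apply (prim_bound k (W / 2)); simpl; lra|].
      simpl INR. rewrite ln_1, Rplus_0_r, pow1.
      unfold Rpower. rewrite ln_1, Rmult_0_r, exp_0, !Rmult_1_r.
      apply Rmult_le_compat_l; [lra|]. apply Rinv_le_contravar; lra.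
  - eapply Rle_trans; [exact H1|].
    assert (Cmod (s + h)%C <= Cmod s + c).
    { eapply Rle_trans; [apply Cmod_triangle|]. lra. }
    assert (0 <= Cmod (s + h)%C) by apply Cmod_ge_0.
    apply Rmult_le_compat.
    + apply Rmult_le_pos; lra.
    + left. apply tailw_pos. lra.
    + apply Rmult_le_compat_l; lra.
    + unfold tailw. apply Rplus_le_compat_l. apply Rinv_le_contravar; lra.
Qed.

(** Taylor's formula of order two by two applications of the mean value inequality, each costing a
    factor 2. The bound on [zapprox (S (S k))] is uniform in [N], so the remainder is too and
    survives the limit. *)
Lemma zapprox_quadratic k s : 0 < Re s -> (1 - s)%C <> 0%C ->
  exists K d, 0 < d /\ 0 <= K /\ forall h, Cmod h <= d ->
    0 < Re (s + h)%C /\ (1 - (s + h))%C <> 0%C /\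
    forall N, Cmod (zapprox k (s + h) N - zapprox k s N - h * zapprox (S k) s N)%C
      <= K * (Cmod h * Cmod h).
Proof.
  intros Hs Hs1.
  destruct (zapprox_locally_bounded (S (S k)) s Hs Hs1) as [K [d [Hd [HK H]]]].
  exists (4 * K), d. split; auto. split; [lra|]. intros h Hh.
  destruct (H h Hh) as [H1 [H2 _]]. split; auto. split; auto. intros N.
  assert (Hh0 := Cmod_ge_0 h).
  assert (Hu : forall u, 0 <= u <= 1 -> Cmod (h * RtoC u)%C <= d).
  { intros u Hu. rewrite Cmod_mult, Cmod_R, Rabs_pos_eq by lra. nra. }
  assert (E0 : forall j, zapprox j (s + h * RtoC 0) N = zapprox j s N).
  { intros j. f_equal. ring. }
  assert (Hstep : forall u, 0 <= u <= 1 ->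
    Cmod (zapprox (S k) (s + h * RtoC u) N - zapprox (S k) s N)%C <= 2 * (Cmod h * K)).
  { intros u Hu1. rewrite <- (E0 (S k)).
    eapply Rle_trans.
    - apply (Defs.mvt_C (fun v => zapprox (S k) (s + h * RtoC v) N)%C
        (fun v => h * zapprox (S (S k)) (s + h * RtoC v) N)%C 0 u (Cmod h * K)); [lra| |].
      + intros x Hx. apply dC_zapprox. apply (H (h * RtoC x)%C). apply Hu; lra.
      + intros x Hx. rewrite Cmod_mult. apply Rmult_le_compat_l; auto.
        apply (H (h * RtoC x)%C). apply Hu; lra.
    - assert (0 <= Cmod h * K) by now apply Rmult_le_pos. nra. }
  pose (g := fun u => (zapprox k (s + h * RtoC u) N + (- h * zapprox (S k) s N) * RtoC u)%C).
  replace (zapprox k (s + h) N - zapprox k s N - h * zapprox (S k) s N)%C with (g 1 - g 0)%C.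
  2: { unfold g. rewrite E0, Cmult_1_r. ring. }
  replace (4 * K * (Cmod h * Cmod h)) with (2 * (Cmod h * (2 * (Cmod h * K)) * (1 - 0))) by ring.
  apply (Defs.mvt_C g (fun u => h * (zapprox (S k) (s + h * RtoC u) N - zapprox (S k) s N))%C);
    [lra| |].
  - intros x Hx. unfold g. eapply Defs.dC_eq.
    2: { apply Defs.dC_plus; [apply dC_zapprox|].
         - apply (H (h * RtoC x)%C). apply Hu; lra.
         - apply (Defs.dC_mult (- h * zapprox (S k) s N)%C RtoC (RtoC 1)).
           split; simpl; [apply @is_derive_id|apply @is_derive_const]. }
    ring.
  - intros x Hx. rewrite Cmod_mult. apply Rmult_le_compat_l; auto.
Qed.

(** In the limit the uniform quadratic estimate says that [zeta_deriv k] has at [s] a complex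
    derivative equal to the limit of [zapprox (S k) s]. *)
Lemma clim_zeta_deriv k : forall s, 0 < Re s -> (1 - s)%C <> 0%C ->
  Defs.clim (zapprox k s) (zeta_deriv k s).
Proof.
  induction k as [|k IH]; intros s Hs Hs1.
  - eapply Defs.clim_ext; [intros N; symmetry; apply zapprox_0|].
    apply Defs.clim_zeta_approx; auto. intros ->. apply Hs1. ring.
  - destruct (zapprox_cvg (S k) s Hs Hs1) as [l Hl].
    replace (zeta_deriv (S k) s) with l; auto. symmetry.
    change (C_derive (zeta_deriv k) s = l). apply is_C_derive_unique.
    destruct (zapprox_quadratic k s Hs Hs1) as [K [d [Hd [HK H]]]].
    apply Defs.is_derive_quadratic with (2 * K) d; auto; [lra|].
    intros h Hh. destruct (H h Hh) as [H1 [H2 H3]].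
    rewrite Rmult_assoc. refine (clim_Cmod_le _ _ _ _ H3).
    replace (zeta_deriv k (s + h) - zeta_deriv k s - h * l)%C with
      (zeta_deriv k (s + h) + (-1) * zeta_deriv k s + (- h) * l)%C by ring.
    eapply Defs.clim_ext; [intros N|apply Defs.clim_plus;
      [apply Defs.clim_plus; [exact (IH _ H1 H2)|apply Defs.clim_mult, (IH _ Hs Hs1)]|
       apply Defs.clim_mult, Hl]].
    simpl. ring.
Qed.

(** * The truncated Dirichlet series *)

Definition lsum {X : Type} (f : X -> R) (l : list X) : R :=
  fold_right (fun x r => f x + r) 0 l.

Lemma lsum_app {X} (f : X -> R) l l' : lsum f (l ++ l') = lsum f l + lsum f l'.
Proof. induction l as [|x l IH]; simpl; [ring|]. rewrite IH. ring. Qed.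

Lemma lsum_seq_S (f : nat -> R) N : lsum f (seq 1 (S N)) = sum_n (fun m => f (S m)) N.
Proof.
  induction N as [|N IH]; [rewrite sum_O; simpl; ring|].
  rewrite sum_Sn, <- IH, (seq_S (S N)), lsum_app. simpl.
  change (plus ?x ?y) with (x + y). ring.
Qed.

Lemma Re_sum_n (f : nat -> C) N : Re (sum_n f N) = sum_n (fun m => Re (f m)) N.
Proof.
  induction N as [|N IH]; [now rewrite !sum_O|]. rewrite !sum_Sn, <- IH. reflexivity.
Qed.

(** The real part of the sum in [zapprox] without its sign (-1)^k. Dropping the sign makes all
    cosine coefficients nonnegative. *)
Definition dirichlet (k : nat) (sigma : R) (N : nat) (t : R) : R :=
  lsum (fun m => (ln (INR m)) ^ k * Rpower (INR m) (- sigma) * cos (t * ln (INR m))) (seq 1 N).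

(** For sigma >= 15/16 the subtracted primitive is at most x^(1/16) / t up to logarithms. With the
    loss 1/16 in [zapprox_tail] the remainder still decays like a power of exponent at least 7/8,
    and its factor 1 + |s| is at most 3 t. *)
Lemma dirichlet_le_zeta_deriv k : exists B, 0 <= B /\
  forall sigma t N, 15 / 16 <= sigma <= 1 -> 1 <= t ->
  dirichlet k sigma (S (S N)) t <= Cmod (zeta_deriv k (sigma, t))
    + B * ((1 + ln (INR (S (S N)))) ^ k * Rpower (INR (S (S N))) (/ 16) / t
           + t * Rpower (INR (S N)) (- (7 / 8))).
Proof.
  destruct (zapprox_tail k (/ 16)) as [B [HB H]]; [lra|].
  assert (HP := primw_pos k 1 ltac:(lra)). set (P := primw k 1) in *.
  exists (P + 2 * (B * 3 * (8 / 7))). split; [lra|]. intros sigma t N Hsig Ht.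
  set (s := (sigma, t) : C).
  assert (Hst : t <= Cmod (1 - s)%C).
  { eapply Rle_trans; [|apply Defs.Im_le_Cmod]. simpl.
    replace (0 + - t) with (- t) by ring. rewrite Rabs_Ropp. apply Rle_abs. }
  assert (Hs1 : (1 - s)%C <> 0%C) by (apply Cmod_gt_0; lra).
  assert (Hcl := clim_zeta_deriv k s ltac:(simpl; lra) Hs1).
  destruct (H s Hs1) as [_ HT]; [simpl; lra|].
  specialize (HT _ Hcl (S N)).
  set (x := INR (S (S N))) in *. assert (Hx : 1 <= x) by apply Defs.INR_S_pos.
  assert (Hy := Defs.INR_S_pos N). set (y := INR (S N)) in *.
  assert (HL := ln_ge0 x Hx).
  set (D := sum_n (fun m => RtoC ((- ln (INR (S m))) ^ k) * Cpow (INR (S m)) (- s))%C (S N)).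
  assert (ED : Re D = (-1) ^ k * dirichlet k sigma (S (S N)) t).
  { unfold D, dirichlet. rewrite Re_sum_n, lsum_seq_S.
    rewrite <- (sum_n_mult_l (K := R_Ring)). apply sum_n_ext. intros m.
    assert (Hm := Defs.INR_S_pos m). set (z := INR (S m)) in *.
    change (mult ?a ?b) with (a * b).
    replace ((- ln z) ^ k) with ((-1) ^ k * ln z ^ k) by (rewrite <- Rpow_mult_distr; f_equal; ring).
    unfold Cpow, Cexp, Rpower, s. simpl.
    replace (- sigma * ln z - - t * 0) with (- sigma * ln z) by ring.
    replace (- sigma * 0 + - t * ln z) with (- (t * ln z)) by ring.
    rewrite cos_neg. unfold Re, Im; simpl. ring. }
  assert (Hd : dirichlet k sigma (S (S N)) t <= Cmod D).
  { eapply Rle_trans; [|apply Defs.Re_le_Cmod]. rewrite ED, Rabs_mult, pow_1_abs, Rmult_1_l.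
    apply Rle_abs. }
  eapply Rle_trans; [exact Hd|].
  replace D with (zeta_deriv k s + (prim k s x +
     - (zeta_deriv k s - zapprox k s (S N))))%C.
  2: { unfold zapprox. fold D. fold x. ring. }
  eapply Rle_trans; [apply Cmod_triangle|]. apply Rplus_le_compat_l.
  eapply Rle_trans; [apply Cmod_triangle|]. rewrite Cmod_opp.
  assert (HLk : 0 <= (1 + ln x) ^ k) by (apply pow_le; lra).
  assert (HX : 0 < Rpower x (/ 16)) by apply exp_pos.
  assert (HY : 0 < Rpower y (- (7 / 8))) by apply exp_pos.
  assert (HA : 0 <= (1 + ln x) ^ k * Rpower x (/ 16) / t).
  { apply Rdiv_le_0_compat; [apply Rmult_le_pos|]; lra. }
  assert (HB' : 0 <= t * Rpower y (- (7 / 8))) by (apply Rmult_le_pos; lra).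
  assert (B1 : Cmod (prim k s x) <= P * ((1 + ln x) ^ k * Rpower x (/ 16) / t)).
  { eapply Rle_trans; [apply (prim_bound k 1); lra|]. fold P.
    unfold Rdiv. rewrite <- !Rmult_assoc. apply Rmult_le_compat.
    - apply Rmult_le_pos; [apply Rmult_le_pos; lra|left; apply exp_pos].
    - left; apply Rinv_0_lt_compat; lra.
    - apply Rmult_le_compat_l; [apply Rmult_le_pos; lra|].
      apply Rle_Rpower; [lra|simpl; lra].
    - apply Rinv_le_contravar; lra. }
  assert (B2 : Cmod (zeta_deriv k s - zapprox k s (S N))%C
     <= 2 * (B * 3 * (8 / 7)) * (t * Rpower y (- (7 / 8)))).
  { eapply Rle_trans; [exact HT|]. rewrite !(Rmult_assoc 2). apply Rmult_le_compat_l; [lra|].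
    assert (Hcs : 1 + Cmod s <= 3 * t).
    { assert (Hc := Defs.Cmod_le_abs s). unfold s in *. simpl in Hc.
      rewrite !Rabs_pos_eq in Hc by lra. lra. }
    replace (B * 3 * (8 / 7) * (t * Rpower y (- (7 / 8)))) with
      ((B * (3 * t)) * ((8 / 7) * Rpower y (- (7 / 8)))) by ring.
    assert (Hcs0 := Cmod_ge_0 s).
    apply Rmult_le_compat.
    - apply Rmult_le_pos; lra.
    - left. apply tailw_pos. simpl; lra.
    - apply Rmult_le_compat_l; auto.
    - unfold tailw. fold y. change (Re s) with sigma.
      apply Rmult_le_compat.
      + left; apply Rinv_0_lt_compat; lra.
      + left; apply exp_pos.
      + replace (8 / 7) with (/ (7 / 8)) by field. apply Rinv_le_contravar; lra.
      + apply Rle_Rpower; lra. }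
  assert (0 <= 2 * (B * 3 * (8 / 7)) * ((1 + ln x) ^ k * Rpower x (/ 16) / t))
    by (apply Rmult_le_pos; lra).
  assert (0 <= P * (t * Rpower y (- (7 / 8)))) by (apply Rmult_le_pos; lra).
  lra.
Qed.

(** * Nonnegative cosine polynomials and their means *)

Lemma lsum_ext {X} (f g : X -> R) l : (forall x, In x l -> f x = g x) -> lsum f l = lsum g l.
Proof.
  induction l as [|x l IH]; intros H; simpl; auto.
  rewrite H, IH; auto; [intros; apply H; now right|now left].
Qed.

Lemma lsum_le {X} (f g : X -> R) l : (forall x, In x l -> f x <= g x) -> lsum f l <= lsum g l.
Proof.
  induction l as [|x l IH]; intros H; simpl; [lra|].
  apply Rplus_le_compat; [apply H; now left|apply IH; intros; apply H; now right].
Qed.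

Lemma lsum_const {X} (c : R) (l : list X) : lsum (fun _ => c) l = INR (length l) * c.
Proof.
  induction l as [|x l IH]; simpl length; [simpl; ring|]. rewrite S_INR. simpl. rewrite IH. ring.
Qed.

Lemma lsum_plus {X} (f g : X -> R) l : lsum (fun x => f x + g x) l = lsum f l + lsum g l.
Proof. induction l as [|x l IH]; simpl; [ring|]. rewrite IH. ring. Qed.

Lemma lsum_scal {X} c (f : X -> R) l : lsum (fun x => c * f x) l = c * lsum f l.
Proof. induction l as [|x l IH]; simpl; [ring|]. rewrite IH. ring. Qed.

Lemma lsum_map {X Y} (h : X -> Y) (f : Y -> R) l : lsum f (map h l) = lsum (fun x => f (h x)) l.
Proof. induction l as [|x l IH]; simpl; [ring|]. now rewrite IH. Qed.

Lemma lsum_nonneg {X} (f : X -> R) l : (forall x, In x l -> 0 <= f x) -> 0 <= lsum f l.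
Proof.
  intros H. rewrite <- (Rmult_0_r (INR (length l))), <- (lsum_const 0 l). now apply lsum_le.
Qed.

Lemma lsum_incl {X} (f : X -> R) l l' : NoDup l -> incl l l' ->
  (forall x, In x l' -> 0 <= f x) -> lsum f l <= lsum f l'.
Proof.
  intros Hl. revert l'. induction Hl as [|x l Hx Hl IH]; intros l' Hi Hf.
  - now apply lsum_nonneg.
  - destruct (in_split x l') as [l1 [l2 ->]]; [apply Hi; now left|].
    rewrite lsum_app. simpl.
    assert (lsum f l <= lsum f (l1 ++ l2)); [|rewrite lsum_app in H; lra].
    apply IH.
    + intros y Hy. assert (H := Hi y (or_intror Hy)).
      apply in_app_or in H. apply in_or_app. destruct H as [H|[H|H]]; auto.
      subst y. contradiction.
    + intros y Hy. apply Hf. apply in_app_or in Hy. apply in_or_app. simpl. tauto.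
Qed.

(** Cosine polynomials with nonnegative coefficients and frequencies in [S]; such functions are
    positive definite. The inductive form lets products and means be treated by induction on the
    construction, without coefficient lists. *)
Inductive pd (S : R -> Prop) : (R -> R) -> Prop :=
| pd_cos y : S y -> pd S (fun t => cos (t * y))
| pd_zero : pd S (fun _ => 0)
| pd_scal c f : 0 <= c -> pd S f -> pd S (fun t => c * f t)
| pd_plus f g : pd S f -> pd S g -> pd S (fun t => f t + g t)
| pd_ext f g : (forall t, f t = g t) -> pd S f -> pd S g.

Definition anyfreq : R -> Prop := fun _ => True.

Lemma pd_sub (S S' : R -> Prop) f : (forall y, S y -> S' y) -> pd S f -> pd S' f.
Proof.
  intros H Hf. induction Hf.
  - now apply pd_cos, H.
  - apply pd_zero.
  - now apply pd_scal.
  - now apply pd_plus.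
  - now apply pd_ext with f.
Qed.

Lemma pd_cos_mult S S' th f : (forall y, S y -> S' (y + th) /\ S' (y - th)) ->
  pd S f -> pd S' (fun t => cos (t * th) * f t).
Proof.
  intros H Hf. induction Hf as [y Hy| |c f Hc Hf IH|f g Hf IHf Hg IHg|f g E Hf IH].
  - destruct (H y Hy) as [H1 H2].
    apply pd_ext with (fun t => / 2 * (cos (t * (y + th)) + cos (t * (y - th)))).
    + intros t. replace (t * (y + th)) with (t * y + t * th) by ring.
      replace (t * (y - th)) with (t * y - t * th) by ring.
      rewrite cos_plus, cos_minus. field.
    + apply pd_scal; [lra|]. apply pd_plus; now apply pd_cos.
  - apply pd_ext with (fun _ => 0); [intros; ring|apply pd_zero].
  - apply pd_ext with (fun t => c * (cos (t * th) * f t)); [intros; ring|].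
    apply pd_scal; [exact Hc|exact IH].
  - apply pd_ext with (fun t => cos (t * th) * f t + cos (t * th) * g t); [intros; ring|].
    apply pd_plus; [exact IHf|exact IHg].
  - apply pd_ext with (fun t => cos (t * th) * f t); auto. intros t; now rewrite E.
Qed.

Lemma pd_mult f g : pd anyfreq f -> pd anyfreq g -> pd anyfreq (fun t => f t * g t).
Proof.
  intros Hf Hg. induction Hf as [y Hy| |c f Hc Hf IH|f h Hf IHf Hh IHh|f h E Hf IH].
  - apply pd_cos_mult with anyfreq; auto.
  - apply pd_ext with (fun _ => 0); [intros; ring|apply pd_zero].
  - apply pd_ext with (fun t => c * (f t * g t)); [intros; ring|].
    apply pd_scal; [exact Hc|exact IH].
  - apply pd_ext with (fun t => f t * g t + h t * g t); [intros; ring|].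
    apply pd_plus; [exact IHf|exact IHh].
  - apply pd_ext with (fun t => f t * g t); auto. intros t; now rewrite E.
Qed.

Lemma pd_one : pd anyfreq (fun _ => 1).
Proof.
  apply pd_ext with (fun t => cos (t * 0)); [intros t; now rewrite Rmult_0_r, cos_0|].
  now apply pd_cos.
Qed.

(* Averaging over differences of two points makes the mean of every cosine nonnegative. *)
Definition mean (J : nat) (tau : R) (f : R -> R) : R :=
  lsum (fun j => lsum (fun k => f ((INR j - INR k) * tau)) (seq 0 J)) (seq 0 J)
    / (INR J * INR J).

Section Mean.
Variables (J : nat) (tau : R).
Hypothesis HJ : 0 < INR J.

Let HJJ : 0 < INR J * INR J. Proof. now apply Rmult_lt_0_compat. Qed.

Lemma mean_ext f g : (forall t, f t = g t) -> mean J tau f = mean J tau g.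
Proof.
  intros H. unfold mean. f_equal. apply lsum_ext; intros j _. apply lsum_ext; intros k _. apply H.
Qed.

Lemma mean_plus f g : mean J tau (fun t => f t + g t) = mean J tau f + mean J tau g.
Proof.
  unfold mean. rewrite <- Rdiv_plus_distr. f_equal. rewrite <- lsum_plus.
  apply lsum_ext; intros j _. now rewrite <- lsum_plus.
Qed.

Lemma mean_scal c f : mean J tau (fun t => c * f t) = c * mean J tau f.
Proof.
  unfold mean, Rdiv. rewrite <- Rmult_assoc. f_equal. rewrite <- lsum_scal.
  apply lsum_ext; intros j _. now rewrite <- lsum_scal.
Qed.

Lemma mean_const c : mean J tau (fun _ => c) = c.
Proof.
  unfold mean. rewrite (lsum_ext _ (fun _ => INR J * c)).
  - rewrite lsum_const, length_seq. field. lra.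
  - intros j _. now rewrite lsum_const, length_seq.
Qed.

Lemma mean_le f g :
  (forall j k, (j < J)%nat -> (k < J)%nat ->
     f ((INR j - INR k) * tau) <= g ((INR j - INR k) * tau)) ->
  mean J tau f <= mean J tau g.
Proof.
  intros H. unfold mean. apply Rmult_le_compat_r; [left; now apply Rinv_0_lt_compat|].
  apply lsum_le; intros j Hj. apply lsum_le; intros k Hk.
  apply in_seq in Hj, Hk. apply H; lia.
Qed.

Lemma mean_lsum {X} (f : X -> R -> R) l :
  mean J tau (fun t => lsum (fun x => f x t) l) = lsum (fun x => mean J tau (f x)) l.
Proof.
  induction l as [|x l IH]; simpl; [apply mean_const|]. now rewrite mean_plus, IH.
Qed.

(** A Fejér kernel: the double sum of cos((j - k) th) is the squared modulus of the sum of e^(i j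
    th), here split into cosines and sines. *)
Lemma mean_cos y : mean J tau (fun t => cos (t * y)) =
  (lsum (fun j => cos (INR j * (tau * y))) (seq 0 J) ^ 2
   + lsum (fun j => sin (INR j * (tau * y))) (seq 0 J) ^ 2) / (INR J * INR J).
Proof.
  unfold mean. f_equal. set (l := seq 0 J).
  set (u := fun j => cos (INR j * (tau * y))). set (v := fun j => sin (INR j * (tau * y))).
  rewrite (lsum_ext _ (fun j => lsum u l * u j + lsum v l * v j)).
  - rewrite lsum_plus, !lsum_scal. ring.
  - intros j _. rewrite (lsum_ext _ (fun k => u j * u k + v j * v k)).
    + rewrite lsum_plus, !lsum_scal. ring.
    + intros k _. unfold u, v. rewrite <- cos_minus. f_equal. ring.
Qed.

Lemma mean_pd_nonneg S f : pd S f -> 0 <= mean J tau f.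
Proof.
  intros Hf. induction Hf as [y Hy| |c f Hc Hf IH|f g Hf IHf Hg IHg|f g E Hf IH].
  - rewrite mean_cos. apply Rdiv_le_0_compat; auto.
    apply Rplus_le_le_0_compat; apply pow2_ge_0.
  - rewrite mean_const. lra.
  - rewrite mean_scal. now apply Rmult_le_pos.
  - rewrite mean_plus. lra.
  - now rewrite <- (mean_ext _ _ E).
Qed.

(** The value f 0 is the sum of the coefficients, so a bound common to all frequencies is multiplied
    by it. *)
Lemma mean_pd_le S d f : (forall y, S y -> mean J tau (fun t => cos (t * y)) <= d) ->
  pd S f -> mean J tau f <= d * f 0.
Proof.
  intros H Hf. induction Hf as [y Hy| |c f Hc Hf IH|f g Hf IHf Hg IHg|f g E Hf IH].
  - rewrite Rmult_0_l, cos_0, Rmult_1_r. auto.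
  - rewrite mean_const. lra.
  - rewrite mean_scal. apply (Rmult_le_compat_l c) in IH; auto. lra.
  - rewrite mean_plus. lra.
  - now rewrite <- (mean_ext _ _ E), <- E.
Qed.

(** Multiplied by 2 sin(th/2), both the cosine sum and the sine sum telescope to something at most 2
    in absolute value. For |th| <= 1 one has |sin(th/2)| >= |th|/4, and 32 is 2 times 16. *)
Lemma mean_cos_le y : 0 < Rabs (tau * y) <= 1 ->
  mean J tau (fun t => cos (t * y)) <= 32 / (INR J * (tau * y)) ^ 2.
Proof.
  rewrite mean_cos. set (th := tau * y). intros [H0 H1].
  set (s := sin (th / 2)).
  assert (Hs : (th / 4) ^ 2 <= s ^ 2).
  { assert (P : forall z, 0 < z <= 1 -> z / 4 <= sin (z / 2)).
    { intros z Hz.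
      (* At index 0 this is sin x >= x - x^3 / 6. *)
      assert (HA := proj1 (sin_bound (z / 2) 0 ltac:(lra) ltac:(assert (P := PI2_1); lra))).
      unfold sin_approx, sin_term in HA. simpl in HA.
      assert (z * z <= 1) by nra. nra. }
    unfold s. destruct (Rle_lt_dec 0 th) as [Hth|Hth].
    - rewrite Rabs_pos_eq in H0, H1 by auto.
      assert (Q := P th ltac:(lra)). apply pow_incr; lra.
    - rewrite Rabs_left in H0, H1 by auto.
      assert (Q := P (- th) ltac:(lra)).
      replace (- th / 2) with (- (th / 2)) in Q by lra. rewrite sin_neg in Q.
      replace ((th / 4) ^ 2) with ((- th / 4) ^ 2) by (simpl; lra).
      replace (sin (th / 2) ^ 2) with ((- sin (th / 2)) ^ 2) by ring.
      apply pow_incr; lra. }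
  assert (Ht2 : 0 < th ^ 2).
  { rewrite <- (Rabs_pos_eq (th ^ 2)) by apply pow2_ge_0. rewrite <- RPow_abs.
    now apply pow_lt. }
  assert (EC : 2 * s * lsum (fun j => cos (INR j * th)) (seq 0 J)
     = sin ((INR J - / 2) * th) + s).
  { clear. induction J as [|n IH].
    - simpl. replace ((0 - / 2) * th) with (- (th / 2)) by lra. rewrite sin_neg. unfold s. ring.
    - rewrite seq_S, lsum_app, Rmult_plus_distr_l, IH. simpl lsum. rewrite S_INR. simpl Nat.add.
      replace ((INR n + 1 - / 2) * th) with (INR n * th + th / 2) by lra.
      replace ((INR n - / 2) * th) with (INR n * th - th / 2) by lra.
      rewrite sin_plus, sin_minus. unfold s. ring. }
  assert (ES : 2 * s * lsum (fun j => sin (INR j * th)) (seq 0 J)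
     = cos (th / 2) - cos ((INR J - / 2) * th)).
  { clear. induction J as [|n IH].
    - simpl. replace ((0 - / 2) * th) with (- (th / 2)) by lra. rewrite cos_neg. unfold s. ring.
    - rewrite seq_S, lsum_app, Rmult_plus_distr_l, IH. simpl lsum. rewrite S_INR. simpl Nat.add.
      replace ((INR n + 1 - / 2) * th) with (INR n * th + th / 2) by lra.
      replace ((INR n - / 2) * th) with (INR n * th - th / 2) by lra.
      rewrite cos_plus, cos_minus. unfold s. ring. }
  set (A := lsum (fun j => cos (INR j * th)) (seq 0 J)) in *.
  set (B := lsum (fun j => sin (INR j * th)) (seq 0 J)) in *.
  assert (HAB : s ^ 2 * (A ^ 2 + B ^ 2) <= 2).
  { replace (s ^ 2 * (A ^ 2 + B ^ 2)) with (((2 * s * A) ^ 2 + (2 * s * B) ^ 2) / 4) by field.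
    rewrite EC, ES.
    assert (S1 := SIN_bound ((INR J - / 2) * th)). assert (S2 := COS_bound ((INR J - / 2) * th)).
    assert (S3 := SIN_bound (th / 2)). assert (S4 := COS_bound (th / 2)).
    fold s in S3.
    assert (Q : forall a b, -1 <= a <= 1 -> -1 <= b <= 1 -> (a + b) ^ 2 <= 4).
    { intros a b Ha Hb.
      assert (0 <= (2 - (a + b)) * (2 + (a + b))) by (apply Rmult_le_pos; lra). simpl. lra. }
    assert (Q1 := Q _ _ S1 S3).
    assert (Q2 : (cos (th / 2) - cos ((INR J - / 2) * th)) ^ 2 <= 4)
      by (apply (Q _ (- cos ((INR J - / 2) * th))); lra).
    lra. }
  assert (H32 : th ^ 2 * (A ^ 2 + B ^ 2) <= 32).
  { assert (0 <= A ^ 2 + B ^ 2) by (apply Rplus_le_le_0_compat; apply pow2_ge_0).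
    apply (Rmult_le_compat_r (A ^ 2 + B ^ 2)) in Hs; auto.
    replace ((th / 4) ^ 2) with (th ^ 2 / 16) in Hs by field. lra. }
  apply Rmult_le_reg_r with (INR J * INR J * th ^ 2).
  { now apply Rmult_lt_0_compat. }
  assert (th <> 0) by (intros E; rewrite E in Ht2; simpl in Ht2; lra).
  replace ((A ^ 2 + B ^ 2) / (INR J * INR J) * (INR J * INR J * th ^ 2)) with
    (th ^ 2 * (A ^ 2 + B ^ 2)) by (field; lra).
  replace (32 / (INR J * th) ^ 2 * (INR J * INR J * th ^ 2)) with 32 by (field; lra).
  exact H32.
Qed.

Lemma mean_indicator D : 0 < tau ->
  mean J tau (fun t => if Rlt_dec (Rabs t) (INR D * tau) then 1 else 0) <= 2 * INR D / INR J.
Proof.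
  intros Ht. unfold mean.
  apply Rle_trans with (lsum (fun _ => 2 * INR D) (seq 0 J) / (INR J * INR J)).
  2: { rewrite lsum_const, length_seq. right. field. lra. }
  apply Rmult_le_compat_r; [left; now apply Rinv_0_lt_compat|].
  apply lsum_le. intros j _.
  replace (2 * INR D) with (INR (2 * D)) by (rewrite mult_INR; simpl; ring).
  apply Rle_trans with (INR (Nat.min J (j + D) - Nat.min J (j - D))); [|apply le_INR; lia].
  clear HJ HJJ. induction J as [|n IH]; [simpl; lra|].
  rewrite seq_S, lsum_app. simpl Nat.add. simpl lsum. rewrite Rplus_0_r.
  eapply Rle_trans; [apply Rplus_le_compat_r, IH|].
  destruct (Rlt_dec _ _) as [Hlt|Hlt].
  - rewrite Rabs_mult, (Rabs_pos_eq tau) in Hlt by lra.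
    apply Rmult_lt_reg_r in Hlt; auto. apply Rabs_lt_between in Hlt.
    assert (H1 : (j < n + D)%nat) by (apply INR_lt; rewrite plus_INR; lra).
    assert (H2 : (n < j + D)%nat) by (apply INR_lt; rewrite plus_INR; lra).
    rewrite <- S_INR. apply le_INR. lia.
  - rewrite Rplus_0_r. apply le_INR. lia.
Qed.
End Mean.

(** * Riesz products *)

Definition riesz (qs : list nat) (t : R) : R :=
  fold_right (fun q w => (1 + cos (t * ln (INR q))) * w) 1 qs.

(* The divisors [m] of the product of [qs], each with weight [2^(- number of factors of m)]. *)
Fixpoint divs (qs : list nat) : list (R * nat) :=
  match qs with
  | nil => (1, 1%nat) :: nil
  | q :: l => divs l ++ map (fun p => (fst p / 2, (q * snd p)%nat)) (divs l)
  end.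

Lemma prodl_pos qs : indep qs -> (0 < prodl qs)%nat.
Proof.
  induction qs as [|q l IH]; simpl; [lia|]. intros [H1 [_ H2]].
  apply Nat.mul_pos_pos; auto.
Qed.

Lemma divs_divide qs p : In p (divs qs) -> Nat.divide (snd p) (prodl qs).
Proof.
  revert p. induction qs as [|q l IH]; intros p; simpl.
  - intros [<-|[]]. apply Nat.divide_refl.
  - intros H. apply in_app_or in H. destruct H as [H|H].
    + apply Nat.divide_mul_r. now apply IH.
    + apply in_map_iff in H. destruct H as [p' [<- H]]. simpl.
      apply Nat.mul_divide_mono_l. now apply IH.
Qed.

(** An element common to both halves would be a multiple of [q] dividing the product of the
    remaining factors, against [indep]. *)
Lemma divs_NoDup qs : indep qs -> NoDup (map snd (divs qs)).
Proof.
  induction qs as [|q l IH]; simpl.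
  - intros _. repeat constructor. intros [].
  - intros [Hq [Hd Hl]]. specialize (IH Hl). rewrite map_app, map_map. simpl.
    apply NoDup_app; auto.
    + rewrite <- (map_map snd (fun m => (q * m)%nat)).
      apply Injective_map_NoDup; auto. intros x y Hxy.
      apply Nat.mul_cancel_l in Hxy; lia.
    + intros m Hm1 Hm2. apply Hd.
      apply in_map_iff in Hm1. destruct Hm1 as [p1 [<- H1]].
      apply in_map_iff in Hm2. destruct Hm2 as [p2 [E H2]].
      apply Nat.divide_trans with (snd p1); [|now apply divs_divide].
      exists (snd p2). lia.
Qed.

Lemma divs_weight_nonneg qs p : In p (divs qs) -> 0 <= fst p.
Proof.
  revert p. induction qs as [|q l IH]; intros p; simpl.
  - intros [<-|[]]. simpl; lra.
  - intros H. apply in_app_or in H. destruct H as [H|H]; auto.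
    apply in_map_iff in H. destruct H as [p' [<- H]]. simpl. specialize (IH _ H). lra.
Qed.

Lemma divs_bounds qs p : indep qs -> In p (divs qs) -> (1 <= snd p <= prodl qs)%nat.
Proof.
  intros Hi Hp. assert (HP := prodl_pos qs Hi). assert (HD := divs_divide qs p Hp).
  split; [|apply Nat.divide_pos_le; auto].
  destruct (snd p); [|lia]. destruct HD as [z Hz]. lia.
Qed.

Lemma ln_INR_mult a b : (0 < a)%nat -> (0 < b)%nat ->
  ln (INR (a * b)) = ln (INR a) + ln (INR b).
Proof. intros Ha Hb. rewrite mult_INR. apply ln_mult; now apply lt_0_INR. Qed.

Lemma riesz_pd qs : pd anyfreq (riesz qs).
Proof.
  induction qs as [|q l IH]; simpl; [apply pd_one|].
  apply (pd_mult (fun t => 1 + cos (t * ln (INR q))) (riesz l)); auto.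
  apply (pd_plus _ (fun _ => 1) (fun t => cos (t * ln (INR q)))); [apply pd_one|now apply pd_cos].
Qed.

(** With a = t log q and b = t log m', the identity (1 + cos a) cos(a + b) = cos(b)/2 + cos(a + b) +
    cos(2a + b)/2 halves the weight when m = q m'. If m comes from the remaining primes, the factor
    only adds nonnegative terms. Taking means then shows that W(t) cos(t log m) averages at least
    the weight of m. *)
Lemma riesz_cos_lower qs p : indep qs -> In p (divs qs) ->
  pd anyfreq (fun t => riesz qs t * cos (t * ln (INR (snd p))) + - fst p).
Proof.
  revert p. induction qs as [|q l IH]; intros p Hi; simpl divs.
  - intros [<-|[]]. apply pd_ext with (fun _ => 0); [|apply pd_zero].
    intros t. simpl. rewrite ln_1, Rmult_0_r, cos_0. ring.
  - destruct Hi as [Hq [Hd Hl]]. intros H. apply in_app_or in H. destruct H as [H|H].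
    + apply pd_ext with (fun t => (riesz l t * cos (t * ln (INR (snd p))) + - fst p)
         + cos (t * ln (INR q)) * (riesz l t * cos (t * ln (INR (snd p))))).
      { intros t. simpl. ring. }
      apply pd_plus; [now apply IH|].
      apply pd_mult; [now apply pd_cos|].
      apply pd_mult; [apply riesz_pd|now apply pd_cos].
    + apply in_map_iff in H. destruct H as [p' [<- H]]. cbn [fst snd].
      assert (Hb := divs_bounds l p' Hl H).
      rewrite ln_INR_mult by lia.
      set (th := ln (INR q)). set (y := ln (INR (snd p'))).
      apply pd_ext with (fun t => / 2 * (riesz l t * cos (t * y) + - fst p')
         + riesz l t * (cos (t * (th + y)) + / 2 * cos (t * (th + (th + y))))).
      { intros t. simpl. fold th.
        replace (t * (th + (th + y))) with (t * th + t * (th + y)) by ring.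
        replace (t * y) with (t * (th + y) - t * th) by ring.
        rewrite cos_plus, cos_minus. field. }
      apply pd_plus.
      * apply pd_scal; [lra|]. now apply IH.
      * apply pd_mult; [apply riesz_pd|].
        apply pd_plus; [now apply pd_cos|]. apply pd_scal; [lra|now apply pd_cos].
Qed.

(** In the expansion of the Riesz product each prime enters the numerator a, the denominator b, or
    neither, hence the condition that ab divides P. *)
Definition offdiag (P : nat) (y : R) : Prop :=
  exists a b : nat, a <> b /\ Nat.divide (a * b) P /\ y = ln (INR a) - ln (INR b).

(** A new factor multiplies a or b by [q]. An equality q a = b or a = q b would make [q] divide ab
    and so the product of the other primes; thus no frequency becomes 0 and the constant term of W
    stays 1. *)
Lemma riesz_offdiag qs : indep qs -> pd (offdiag (prodl qs)) (fun t => riesz qs t + - (1)).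
Proof.
  induction qs as [|q l IH].
  - intros _. apply pd_ext with (fun _ => 0); [intros t; simpl; ring|apply pd_zero].
  - intros [Hq [Hd Hl]]. assert (HP := prodl_pos l Hl).
    apply pd_ext with (fun t => cos (t * ln (INR q)) + ((riesz l t + - (1))
      + cos (t * ln (INR q)) * (riesz l t + - (1)))).
    { intros t. simpl. ring. }
    apply pd_plus; [|apply pd_plus].
    + apply pd_cos. exists q, 1%nat. split; [|split].
      * intros ->. apply Hd. apply Nat.divide_1_l.
      * simpl. apply Nat.mul_divide_mono_l. apply Nat.divide_1_l.
      * simpl. rewrite ln_1. ring.
    + apply pd_sub with (2 := IH Hl). intros y [a [b [H1 [H2 H3]]]].
      exists a, b. split; auto. split; auto. simpl. now apply Nat.divide_mul_r.
    + apply pd_cos_mult with (2 := IH Hl). intros y [a [b [H1 [H2 ->]]]].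
      assert (Hab : (0 < a * b)%nat).
      { destruct H2 as [z Hz]. destruct (a * b)%nat; lia. }
      assert (Ha : (0 < a)%nat) by (destruct a; simpl in Hab; lia).
      assert (Hb : (0 < b)%nat) by (destruct b; lia).
      split.
      * exists (q * a)%nat, b. split; [|split].
        -- intros E. apply Hd. apply Nat.divide_trans with (a * b)%nat; auto.
           exists (a * a)%nat. lia.
        -- replace (q * a * b)%nat with (q * (a * b))%nat by ring. simpl.
           now apply Nat.mul_divide_mono_l.
        -- rewrite ln_INR_mult by auto. ring.
      * exists a, (q * b)%nat. split; [|split].
        -- intros E. apply Hd. apply Nat.divide_trans with (a * b)%nat; auto.
           exists (b * b)%nat. lia.
        -- replace (a * (q * b))%nat with (q * (a * b))%nat by ring. simpl.
           now apply Nat.mul_divide_mono_l.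
        -- rewrite ln_INR_mult by auto. ring.
Qed.

Lemma riesz_bounds qs t : 0 <= riesz qs t <= 2 ^ length qs.
Proof.
  induction qs as [|q l IH]; simpl; [lra|].
  assert (H := COS_bound (t * ln (INR q))). split.
  - apply Rmult_le_pos; lra.
  - apply Rmult_le_compat; lra.
Qed.

Lemma divs_sum qs sigma : indep qs ->
  lsum (fun p => fst p * Rpower (INR (snd p)) (- sigma)) (divs qs)
  = fold_right (fun q w => (1 + Rpower (INR q) (- sigma) / 2) * w) 1 qs.
Proof.
  induction qs as [|q l IH]; intros Hi.
  - simpl. unfold Rpower. rewrite ln_1, Rmult_0_r, exp_0. ring.
  - destruct Hi as [Hq [Hd Hl]]. simpl divs. rewrite lsum_app, lsum_map. cbn [fst snd fold_right].
    rewrite <- (IH Hl).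
    rewrite (lsum_ext (fun p => fst p / 2 * Rpower (INR (q * snd p)) (- sigma))
      (fun p => Rpower (INR q) (- sigma) / 2 * (fst p * Rpower (INR (snd p)) (- sigma)))).
    + rewrite lsum_scal. ring.
    + intros p Hp. assert (Hb := divs_bounds l p Hl Hp).
      unfold Rpower. rewrite ln_INR_mult, Rmult_plus_distr_l, exp_plus by lia. field.
Qed.

(** Each factor is at least 1 + z/2 with z = x^(-sigma), and exp(z/4) <= 1/(1 - z/4) <= 1 + z/2 on
    (0, 1]. *)
Lemma divs_prod_lower qs sigma x : 0 <= sigma -> 1 <= x ->
  (forall q, In q qs -> (1 <= q)%nat /\ INR q <= x) ->
  exp (INR (length qs) * (Rpower x (- sigma) / 4))
  <= fold_right (fun q w => (1 + Rpower (INR q) (- sigma) / 2) * w) 1 qs.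
Proof.
  intros Hs Hx. set (z := Rpower x (- sigma)).
  assert (Hz : 0 < z <= 1).
  { split; [apply exp_pos|]. unfold z. rewrite <- (Rpower_O x) by lra. apply Rle_Rpower; lra. }
  assert (Hez : exp (z / 4) <= 1 + z / 2).
  { assert (H := exp_ineq1_le (- (z / 4))). rewrite exp_Ropp in H.
    assert (He := exp_pos (z / 4)).
    apply (Rmult_le_compat_l (exp (z / 4))) in H; [|lra]. rewrite Rinv_r in H by lra.
    assert (exp (z / 4) <= / (1 - z / 4)).
    { apply Rmult_le_reg_r with (1 - z / 4); [lra|]. rewrite Rinv_l by lra. lra. }
    assert (/ (1 - z / 4) <= 1 + z / 2); [|lra].
    apply Rmult_le_reg_r with (1 - z / 4); [lra|]. rewrite Rinv_l by lra. nra. }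
  induction qs as [|q l IH]; intros H.
  - simpl. rewrite Rmult_0_l, exp_0. lra.
  - cbn [length fold_right]. rewrite S_INR, Rmult_plus_distr_r, Rmult_1_l, Rplus_comm, exp_plus.
    destruct (H q (or_introl eq_refl)) as [Hq1 Hq2].
    assert (1 <= INR q) by (change 1 with (INR 1); now apply le_INR).
    assert (z <= Rpower (INR q) (- sigma)) by (apply Defs.Rpower_neg_le; lra).
    apply Rmult_le_compat; try (left; apply exp_pos); [lra|].
    apply IH. intros; apply H; now right.
Qed.

(** Distinct positive integers a, b <= P satisfy 1/P <= |log a - log b| <= log P <= n. With step 1/n
    each phase therefore has absolute value between 1/(nP) and 1, the range of [mean_cos_le]. The
    coefficients of W sum to at most 2^K. *)
Lemma mean_riesz_le J n qs : indep qs -> (0 < n)%nat -> (0 < J)%nat ->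
  ln (INR (prodl qs)) <= INR n ->
  mean J (/ INR n) (riesz qs) <=
    1 + 32 * (INR n * INR (prodl qs) / INR J) ^ 2 * 2 ^ length qs.
Proof.
  intros Hi Hn HJ Hln.
  assert (Hn1 : 1 <= INR n) by (change 1 with (INR 1); now apply le_INR).
  assert (HJ1 : 0 < INR J) by now apply lt_0_INR.
  assert (HP := prodl_pos qs Hi). set (P := prodl qs) in *.
  assert (HP1 : 1 <= INR P) by (change 1 with (INR 1); now apply le_INR).
  assert (Hin : 0 < / INR n) by (apply Rinv_0_lt_compat; lra).
  rewrite (mean_ext J _ (riesz qs) (fun t => 1 + (riesz qs t + - (1)))) by (intros; ring).
  rewrite (mean_plus J _ (fun _ => 1)), mean_const by auto.
  apply Rplus_le_compat_l.
  assert (Hb := riesz_bounds qs 0).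
  set (d := 32 * (INR n * INR P / INR J) ^ 2).
  assert (Hd : 0 <= d) by (unfold d; apply Rmult_le_pos; [lra|apply pow2_ge_0]).
  apply Rle_trans with (d * (riesz qs 0 + - (1))).
  2: { apply Rmult_le_compat_l; lra. }
  apply (mean_pd_le J _ HJ1 (offdiag P)); [|now apply riesz_offdiag].
  intros y [a [b [Hab [Hdv ->]]]].
  assert (Hab0 : (0 < a * b)%nat) by (destruct Hdv as [z Hz]; destruct (a * b)%nat; lia).
  assert (Hle := Nat.divide_pos_le _ _ HP Hdv).
  assert (Ha : (1 <= a)%nat) by (destruct a; simpl in Hab0; lia).
  assert (Hb' : (1 <= b)%nat) by (destruct b; lia).
  assert (HaP : INR a <= INR P) by (apply le_INR; nia).
  assert (HbP : INR b <= INR P) by (apply le_INR; nia).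
  assert (Hgap : forall u v : nat, (1 <= u)%nat -> (u < v)%nat -> INR v <= INR P ->
     / INR P <= ln (INR v) - ln (INR u) <= INR n).
  { intros u v Hu Huv HvP.
    assert (1 <= INR u) by (change 1 with (INR 1); now apply le_INR).
    assert (INR u + 1 <= INR v) by (rewrite <- S_INR; apply le_INR; lia).
    split.
    - assert (E := exp_ineq1_le (ln (INR u / INR v))).
      rewrite exp_ln in E by (apply Rdiv_lt_0_compat; lra).
      unfold Rdiv in E. rewrite ln_mult, ln_Rinv in E by (try apply Rinv_0_lt_compat; lra).
      apply Rle_trans with (1 - INR u * / INR v); [|lra].
      apply Rle_trans with (/ INR v); [apply Rinv_le_contravar; lra|].
      apply Rmult_le_reg_r with (INR v); [lra|].
      rewrite Rmult_minus_distr_r, Rmult_assoc, !Rinv_l by lra. lra.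
    - assert (0 <= ln (INR u)) by now apply ln_ge0.
      assert (ln (INR v) <= ln (INR P)) by (apply ln_le; lra). lra. }
  set (y := ln (INR a) - ln (INR b)).
  assert (Hy : / INR P <= Rabs y <= INR n).
  { unfold y. destruct (Nat.lt_total a b) as [Hlt|[Hlt|Hlt]]; [|lia|].
    - assert (G := Hgap a b Ha Hlt HbP).
      assert (0 < / INR P) by (apply Rinv_0_lt_compat; lra).
      rewrite Rabs_left by lra. lra.
    - assert (G := Hgap b a Hb' Hlt HaP).
      assert (0 < / INR P) by (apply Rinv_0_lt_compat; lra).
      rewrite Rabs_pos_eq by lra. lra. }
  assert (HiP : 0 < / INR P) by (apply Rinv_0_lt_compat; lra).
  assert (Habs : Rabs (/ INR n * y) = / INR n * Rabs y).
  { rewrite Rabs_mult, (Rabs_pos_eq (/ INR n)) by lra. reflexivity. }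
  eapply Rle_trans; [apply mean_cos_le; auto|].
  - rewrite Habs. split; [apply Rmult_lt_0_compat; lra|].
    apply Rmult_le_reg_l with (INR n); [lra|]. rewrite <- Rmult_assoc, Rinv_r by lra. lra.
  - unfold d, Rdiv at 1. apply Rmult_le_compat_l; [lra|].
    rewrite <- pow_inv. rewrite <- (pow2_abs (/ _)).
    apply pow_incr. split; [apply Rabs_pos|].
    rewrite Rabs_inv, Rabs_mult, Habs, (Rabs_pos_eq (INR J)) by lra.
    replace (INR n * INR P / INR J) with (/ (INR J * (/ INR n * / INR P))) by (field; lra).
    apply Rinv_le_contravar.
    + apply Rmult_lt_0_compat; auto. now apply Rmult_lt_0_compat.
    + apply Rmult_le_compat_l; [lra|]. apply Rmult_le_compat_l; lra.
Qed.

(** * The resonance argument *)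

Lemma divs_cons qs : exists l, divs qs = (1, 1%nat) :: l.
Proof.
  induction qs as [|q qs [l E]]; [now exists nil|]. simpl. rewrite E. simpl. eauto.
Qed.

(** All divisors other than 1 have logarithm at least log 2. The divisor 1 is given up, whence the
    subtracted 1. *)
Lemma divs_ln_sum qs k sigma : indep qs ->
  ln 2 ^ k * (lsum (fun p => fst p * Rpower (INR (snd p)) (- sigma)) (divs qs) - 1)
  <= lsum (fun p => ln (INR (snd p)) ^ k * Rpower (INR (snd p)) (- sigma) * fst p) (divs qs).
Proof.
  intros Hi. assert (HN := divs_NoDup qs Hi).
  assert (Hb := fun p => divs_bounds qs p Hi). assert (Hw := divs_weight_nonneg qs).
  destruct (divs_cons qs) as [l E]. rewrite E in *. simpl in HN. inversion HN as [|? ? Hn1 Hn2].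
  simpl. unfold Rpower at 1 3. rewrite ln_1, Rmult_0_r, exp_0.
  (* For k = 0 the term of the divisor 1 is 0 ^ 0 = 1, for k > 0 it is 0; nonnegativity covers
     both. *)
  assert (Hz : 0 <= 0 ^ k) by (apply pow_le; lra).
  assert (Hl : ln 2 ^ k * lsum (fun p => fst p * Rpower (INR (snd p)) (- sigma)) l
    <= lsum (fun p => ln (INR (snd p)) ^ k * Rpower (INR (snd p)) (- sigma) * fst p) l).
  { rewrite <- lsum_scal. apply lsum_le. intros p Hp.
    assert (Hp2 : (2 <= snd p)%nat).
    { assert (H1 := proj1 (Hb p (or_intror Hp))).
      assert (snd p <> 1%nat); [|lia]. intros E1. apply Hn1. rewrite <- E1. now apply in_map. }
    apply le_INR in Hp2. change (INR 2) with 2 in Hp2.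
    assert (HL : ln 2 ^ k <= ln (INR (snd p)) ^ k).
    { apply pow_incr. split; [apply ln_ge0; lra|]. apply ln_le; lra. }
    assert (0 <= fst p) by (apply Hw; now right).
    assert (HX := exp_pos (- sigma * ln (INR (snd p)))).
    unfold Rpower. set (X := exp _) in *.
    replace (ln (INR (snd p)) ^ k * X * fst p) with (ln (INR (snd p)) ^ k * (fst p * X)) by ring.
    apply Rmult_le_compat_r; auto. apply Rmult_le_pos; lra. }
  lra.
Qed.

(** Every m contributes a nonnegative mean, so the sum over m <= N may be restricted to the divisors
    of the product of the primes, which are distinct and at most N. *)
Lemma mean_riesz_dirichlet J tau qs k sigma N : indep qs -> 0 < INR J -> (prodl qs <= N)%nat ->
  ln 2 ^ k * (fold_right (fun q w => (1 + Rpower (INR q) (- sigma) / 2) * w) 1 qs - 1)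
  <= mean J tau (fun t => riesz qs t * dirichlet k sigma N t).
Proof.
  intros Hi HJ HN.
  rewrite <- divs_sum by auto. eapply Rle_trans; [now apply divs_ln_sum|].
  set (a := fun m => ln (INR m) ^ k * Rpower (INR m) (- sigma)).
  assert (Ha : forall m, (1 <= m)%nat -> 0 <= a m).
  { intros m Hm. apply le_INR in Hm. apply Rmult_le_pos; [|left; apply exp_pos].
    apply pow_le, ln_ge0, Hm. }
  set (g := fun m => mean J tau (fun t => riesz qs t * cos (t * ln (INR m)))).
  assert (Hg : forall m, 0 <= g m).
  { intros m. apply (mean_pd_nonneg J tau HJ anyfreq).
    apply pd_mult; [apply riesz_pd|now apply pd_cos]. }
  rewrite (mean_ext J tau _ (fun t => lsum (fun m => a m * (riesz qs t * cos (t * ln (INR m))))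
     (seq 1 N))).
  2: { intros t. unfold dirichlet. rewrite <- lsum_scal. apply lsum_ext. intros m _.
       unfold a. ring. }
  rewrite (mean_lsum J tau HJ (fun m t => a m * (riesz qs t * cos (t * ln (INR m))))).
  rewrite (lsum_ext _ (fun m => a m * g m)) by (intros m _; apply mean_scal).
  apply Rle_trans with (lsum (fun m => a m * g m) (map snd (divs qs))).
  - rewrite lsum_map. apply lsum_le. intros p Hp.
    assert (Hb := divs_bounds qs p Hi Hp).
    fold (a (snd p)). apply Rmult_le_compat_l; [apply Ha; lia|].
    assert (H := mean_pd_nonneg J tau HJ _ _ (riesz_cos_lower qs p Hi Hp)).
    rewrite (mean_plus J tau _ (fun _ => - fst p)), mean_const in H by auto.
    unfold g. lra.
  - apply lsum_incl; [now apply divs_NoDup| |].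
    + intros m Hm. apply in_map_iff in Hm. destruct Hm as [p [<- Hp]].
      assert (Hb := divs_bounds qs p Hi Hp). apply in_seq. lia.
    + intros m Hm. apply in_seq in Hm. apply Rmult_le_pos; auto. apply Ha; lia.
Qed.

(** A trivial bound, used for the samples with |t| too small for the comparison with zeta; it rests
    on the sum of 1/sqrt(m) being at most 2 sqrt(N). *)
Lemma dirichlet_bound k sigma N t : / 2 <= sigma -> (1 <= N)%nat ->
  dirichlet k sigma N t <= (1 + ln (INR N)) ^ k * (2 * sqrt (INR N)).
Proof.
  intros Hs HN. assert (HN1 := le_INR _ _ HN). change (INR 1) with 1 in HN1.
  assert (HL := ln_ge0 _ HN1).
  apply Rle_trans with (lsum (fun m => (1 + ln (INR N)) ^ k * / sqrt (INR m)) (seq 1 N)).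
  - apply lsum_le. intros m Hm. apply in_seq in Hm.
    assert (Hm1 : 1 <= INR m) by (change 1 with (INR 1); apply le_INR; lia).
    assert (HmN : INR m <= INR N) by (apply le_INR; lia).
    assert (Hlm := ln_ge0 _ Hm1).
    assert (A1 : ln (INR m) ^ k <= (1 + ln (INR N)) ^ k).
    { apply pow_incr. split; auto. assert (ln (INR m) <= ln (INR N)) by (apply ln_le; lra). lra. }
    assert (A2 : Rpower (INR m) (- sigma) <= / sqrt (INR m)).
    { rewrite <- Rpower_sqrt by lra. rewrite <- Rpower_Ropp. apply Rle_Rpower; lra. }
    assert (A0 : 0 <= ln (INR m) ^ k) by now apply pow_le.
    assert (A3 : 0 < Rpower (INR m) (- sigma)) by apply exp_pos.
    assert (C := COS_bound (t * ln (INR m))).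
    apply Rle_trans with (ln (INR m) ^ k * Rpower (INR m) (- sigma)).
    + rewrite <- (Rmult_1_r (ln (INR m) ^ k * _)) at 2. apply Rmult_le_compat_l; [|lra].
      apply Rmult_le_pos; lra.
    + apply Rmult_le_compat; lra.
  - rewrite lsum_scal. apply Rmult_le_compat_l; [apply pow_le; lra|]. clear.
    induction N as [|n IH]; [simpl; rewrite sqrt_0; lra|].
    rewrite seq_S, lsum_app. unfold lsum at 2. cbn [fold_right]. rewrite Rplus_0_r.
    change (1 + n)%nat with (S n).
    eapply Rle_trans; [apply Rplus_le_compat_r, IH|].
    assert (H0 := pos_INR n). assert (HS := S_INR n). rewrite HS.
    assert (Ha := sqrt_sqrt (INR n) H0). assert (Hb := sqrt_sqrt (INR n + 1) ltac:(lra)).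
    set (a := sqrt (INR n)) in *. set (b := sqrt (INR n + 1)) in *.
    assert (0 <= a) by apply sqrt_pos. assert (0 < b) by (apply sqrt_lt_R0; lra).
    apply Rmult_le_reg_r with b; auto. rewrite Rmult_plus_distr_r, Rinv_l by lra.
    assert (0 <= (b - a) ^ 2) by apply pow2_ge_0. nra.
Qed.

(** The mean runs over differences of both signs, whereas the comparison with zeta is made for
    positive t. *)
Lemma dirichlet_Rabs k sigma N t : dirichlet k sigma N (Rabs t) = dirichlet k sigma N t.
Proof.
  apply lsum_ext. intros m _. f_equal. unfold Rabs. destruct (Rcase_abs t); auto.
  now rewrite Ropp_mult_distr_l_reverse, cos_neg.
Qed.

(** The base 17 + 16 n bounds 1 + log N for the truncation point N = 2^(16 n) + 1 used below, so
    powers of log N are negligible against Q. *)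
Lemma pow_le_two_pow k B : exists n0, forall n, (n0 <= n)%nat ->
  B * (17 + 16 * INR n) ^ k <= 2 ^ n.
Proof.
  (* With this exponent exp(16 + 16 n) becomes 2^((n+1)/2), which leaves 2^((n-1)/2) for the
     constant. *)
  destruct (ln_pow_bound k (ln 2 / 32)) as [B' [HB' H]]; [assert (L := ln_lt_2); lra|].
  destruct (INR_unbounded (4 * (Rabs B * B') + 1)) as [n0 Hn0].
  exists n0. intros n Hn. apply le_INR in Hn.
  assert (Hn' := pos_INR n). assert (HR := Rabs_pos B).
  specialize (H (exp (16 + 16 * INR n))). rewrite ln_exp in H.
  specialize (H ltac:(rewrite <- exp_0; left; apply exp_increasing; lra)).
  unfold Rpower in H. rewrite ln_exp in H.
  replace (1 + (16 + 16 * INR n)) with (17 + 16 * INR n) in H by ring.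
  apply Rle_trans with (Rabs B * (B' * exp (ln 2 / 32 * (16 + 16 * INR n)))).
  { apply Rle_trans with (Rabs B * (17 + 16 * INR n) ^ k).
    - apply Rmult_le_compat_r; [apply pow_le; lra|apply Rle_abs].
    - now apply Rmult_le_compat_l. }
  rewrite <- (Rpower_pow n 2) by lra. unfold Rpower.
  set (z := ln 2 / 32 * (16 + 16 * INR n)).
  replace (INR n * ln 2) with ((INR n - 1) / 2 * ln 2 + z) by (unfold z; field).
  rewrite exp_plus, <- Rmult_assoc. apply Rmult_le_compat_r; [left; apply exp_pos|].
  assert (E := exp_ineq1_le ((INR n - 1) / 2 * ln 2)). assert (L := ln_lt_2).
  assert (0 <= Rabs B * B') by now apply Rmult_le_pos.
  assert (/ 2 * ((INR n - 1) / 2) <= (INR n - 1) / 2 * ln 2) by nra. lra.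
Qed.

(** With J = n Q^13 samples and N = Q^16 + 1, and up to logarithms and constants: the primitive is
    at most Q / Q^3, the remainder Q^13 / Q^14, the samples with |t| < Q^3 contribute at most Q *
    Q^8 * Q^(-10), and the off-diagonal part of the mean of W is at most Q^(-24) * Q. *)
Lemma zeta_deriv_resonance k : exists n0, forall n, (n0 <= n)%nat ->
  forall qs sigma, indep qs -> (forall q, In q qs -> (1 <= q)%nat /\ (q <= 2 * n)%nat) ->
  ((2 * n) ^ length qs <= 2 ^ n)%nat -> 15 / 16 <= sigma <= 1 ->
  exists t, (2 ^ n) ^ 3 <= t <= (2 ^ n) ^ 13 /\
    ln 2 ^ k * (exp (INR (length qs) * (Rpower (2 * INR n) (- sigma) / 4)) - 1)
    <= 2 * Cmod (zeta_deriv k (sigma, t)) + 4.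
Proof.
  destruct (dirichlet_le_zeta_deriv k) as [B [HB Hdz]].
  (* The part 3 B makes the comparison error [e] at most 1; the part 8 does the same for the
     contribution of small |t|. *)
  destruct (pow_le_two_pow k (3 * B + 8)) as [n1 Hn1].
  exists (S n1). intros n Hn qs sigma Hi Hq Hlen Hsig.
  assert (Hn0 : (1 <= n)%nat) by lia.
  assert (HnR : 1 <= INR n) by (change 1 with (INR 1); now apply le_INR).
  specialize (Hn1 n ltac:(lia)).
  set (G := (17 + 16 * INR n) ^ k) in *.
  assert (HG : 1 <= G) by (apply pow_R1_Rle; lra).
  set (q := (2 ^ n)%nat). set (Q := 2 ^ n).
  assert (HqQ : INR q = Q) by (unfold q, Q; rewrite pow_INR; reflexivity).
  fold Q in Hn1. fold q in Hlen. fold Q.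
  assert (HQ2 : 2 <= Q).
  { unfold Q. rewrite <- (pow_1 2) at 1. apply Rle_pow; [lra|lia]. }
  assert (Hq1 : (1 <= q)%nat) by (apply INR_le; rewrite HqQ; simpl; lra).
  set (J := (n * q ^ 13)%nat). set (D := (n * q ^ 3)%nat).
  assert (HJ : INR J = INR n * Q ^ 13) by (unfold J; rewrite mult_INR, pow_INR, HqQ; reflexivity).
  assert (HD : INR D = INR n * Q ^ 3) by (unfold D; rewrite mult_INR, pow_INR, HqQ; reflexivity).
  assert (HQp : forall j, 0 < Q ^ j) by (intros j; apply pow_lt; lra).
  assert (HJ0 : 0 < INR J) by (rewrite HJ; apply Rmult_lt_0_compat; [lra|apply HQp]).
  assert (Hi0 : 0 < / INR n) by (apply Rinv_0_lt_compat; lra).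
  assert (Hq16 : (1 <= q ^ 16)%nat).
  { apply INR_le. rewrite pow_INR, HqQ. simpl (INR 1). apply pow_R1_Rle; lra. }
  (* N' = q^16 - 1 is chosen so that the remainder in [dirichlet_le_zeta_deriv] is a power of S N' =
     q^16 exactly, while the truncation point is N = q^16 + 1. *)
  destruct (q ^ 16)%nat as [|N'] eqn:EN; [lia|].
  assert (HN' : INR (S N') = Q ^ 16) by (rewrite <- EN, pow_INR, HqQ; reflexivity).
  set (N := S (S N')).
  assert (HN : INR N = Q ^ 16 + 1) by (unfold N; rewrite S_INR, HN'; reflexivity).
  assert (HQ16 : 1 <= Q ^ 16) by (apply pow_R1_Rle; lra).
  assert (HP : (prodl qs <= q)%nat).
  { eapply Nat.le_trans; [|exact Hlen]. clear - Hq.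
    induction qs as [|r l IH]; simpl; [lia|].
    apply Nat.mul_le_mono; [apply (Hq r); now left|]. apply IH. intros; apply Hq; now right. }
  assert (HPR : INR (prodl qs) <= Q) by (rewrite <- HqQ; now apply le_INR).
  assert (HP1 : 1 <= INR (prodl qs)).
  { change 1 with (INR 1). apply le_INR. assert (T := prodl_pos qs Hi). lia. }
  assert (HK : 2 ^ length qs <= Q).
  { apply le_INR in Hlen. rewrite pow_INR, HqQ in Hlen. eapply Rle_trans; [|exact Hlen].
    apply pow_incr. rewrite mult_INR. simpl (INR 2). lra. }
  assert (HL : 1 + ln (INR N) <= 17 + 16 * INR n /\ 1 <= 1 + ln (INR N)).
  { split; [|assert (0 <= ln (INR N)) by (apply ln_ge0; lra); lra].
    assert (ln (INR N) <= ln ((2 * Q) ^ 16)).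
    { apply ln_le; [lra|]. rewrite HN, Rpow_mult_distr. assert (1 <= 2 ^ 16) by (apply pow_R1_Rle; lra).
      assert (2 <= 2 ^ 16) by (rewrite <- (pow_1 2) at 1; apply Rle_pow; [lra|lia]). nra. }
    rewrite ln_pow in H by lra. rewrite ln_mult in H by lra.
    unfold Q in H. rewrite ln_pow in H by lra.
    assert (L2 := ln2_le_1).
    replace (INR 16) with 16 in H by (simpl; ring).
    assert (INR n * ln 2 <= INR n) by nra. lra. }
  destruct HL as [HL HL1].
  assert (HLG : (1 + ln (INR N)) ^ k <= G) by (apply pow_incr; lra).
  assert (HLG0 : 0 <= (1 + ln (INR N)) ^ k) by (apply pow_le; lra).
  set (E := exp (INR (length qs) * (Rpower (2 * INR n) (- sigma) / 4))).
  set (A0 := 4 * G * Q ^ 8).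
  assert (HA0 : forall t, dirichlet k sigma N t <= A0).
  { intros t. eapply Rle_trans; [apply dirichlet_bound; [lra|unfold N; lia]|].
    assert (HsN : sqrt (INR N) <= 2 * Q ^ 8).
    { rewrite HN. rewrite <- (sqrt_square (2 * Q ^ 8)) by (assert (T := HQp 8%nat); lra).
      apply sqrt_le_1_alt. replace (2 * Q ^ 8 * (2 * Q ^ 8)) with (4 * Q ^ 16) by ring. lra. }
    assert (0 <= sqrt (INR N)) by apply sqrt_pos.
    unfold A0. replace (4 * G * Q ^ 8) with (G * (2 * (2 * Q ^ 8))) by ring.
    apply Rmult_le_compat; lra. }
  assert (HA0p : 0 <= A0) by (unfold A0; assert (T := HQp 8%nat); nra).
  apply NNPP. intros Hno.
  (* If no sample height works, Y bounds zeta uniformly on the range. Then the mean of W A is at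
     most 2 (Y + 1) + 1, which is less than 2 Y + 4, its lower bound. *)
  set (Y := (ln 2 ^ k * (E - 1) - 4) / 2).
  assert (HY : forall t, Q ^ 3 <= t <= Q ^ 13 -> Cmod (zeta_deriv k (sigma, t)) < Y).
  { intros t Ht. apply Rnot_le_lt. intros Hle. apply Hno. exists t. split; auto.
    unfold Y in Hle. fold E. lra. }
  assert (HY0 : 0 < Y).
  { eapply Rle_lt_trans; [apply Cmod_ge_0|apply (HY (Q ^ 3))].
    split; [lra|]. apply Rle_pow; [lra|lia]. }
  set (e := 3 * B * G / Q).
  assert (He : 0 <= e <= 1).
  { unfold e. split.
    - apply Rdiv_le_0_compat; [|lra]. apply Rmult_le_pos; lra.
    - apply Rmult_le_reg_r with Q; [lra|]. unfold Rdiv. rewrite Rmult_assoc, Rinv_l by lra. nra. }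
  assert (Herr : forall t, Q ^ 3 <= t <= Q ^ 13 -> dirichlet k sigma N t <= Y + e).
  { intros t Ht.
    assert (Ht1 : 1 <= t) by (apply Rle_trans with (Q ^ 3); [apply pow_R1_Rle|]; lra).
    eapply Rle_trans; [apply (Hdz sigma t N'); auto|].
    apply Rplus_le_compat; [left; now apply HY|].
    fold N. rewrite HN'.
    assert (X1 : Rpower (INR N) (/ 16) <= 2 * Q).
    { apply Rle_trans with (Rpower ((2 * Q) ^ 16) (/ 16)).
      - apply Rle_Rpower_l; [lra|]. split; [lra|]. rewrite HN, Rpow_mult_distr.
        assert (2 <= 2 ^ 16) by (rewrite <- (pow_1 2) at 1; apply Rle_pow; [lra|lia]). nra.
      - rewrite <- Rpower_pow by lra. rewrite Rpower_mult.
        replace (INR 16 * / 16) with 1 by (simpl; field). rewrite Rpower_1; lra. }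
    assert (X2 : Rpower (Q ^ 16) (- (7 / 8)) = / Q ^ 14).
    { rewrite <- !Rpower_pow by lra. rewrite Rpower_mult, <- Rpower_Ropp. f_equal. simpl; field. }
    rewrite X2.
    assert (X3 : (1 + ln (INR N)) ^ k * Rpower (INR N) (/ 16) / t <= G * (2 / Q)).
    { apply Rle_trans with (G * (2 * Q) / Q ^ 3).
      - unfold Rdiv. apply Rmult_le_compat.
        + apply Rmult_le_pos; [lra|left; apply exp_pos].
        + left; apply Rinv_0_lt_compat; lra.
        + apply Rmult_le_compat; [lra|left; apply exp_pos|lra|lra].
        + apply Rinv_le_contravar; [apply HQp|lra].
      - replace (G * (2 * Q) / Q ^ 3) with (G * (2 / Q) * / Q) by (field; lra).
        rewrite <- (Rmult_1_r (G * (2 / Q))) at 2. apply Rmult_le_compat_l.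
        + apply Rmult_le_pos; [lra|]. apply Rdiv_le_0_compat; lra.
        + rewrite <- Rinv_1. apply Rinv_le_contravar; lra. }
    assert (X4 : t * / Q ^ 14 <= G * (1 / Q)).
    { apply Rle_trans with (Q ^ 13 * / Q ^ 14).
      - apply Rmult_le_compat_r; [left; apply Rinv_0_lt_compat, HQp|lra].
      - replace (Q ^ 13 * / Q ^ 14) with (1 * (1 / Q)) by (field; lra).
        apply Rmult_le_compat_r; [apply Rdiv_le_0_compat; lra|lra]. }
    unfold e. replace (3 * B * G / Q) with (B * (G * (2 / Q) + G * (1 / Q))) by (field; lra).
    apply Rmult_le_compat_l; lra. }
  assert (Hmain : mean J (/ INR n) (fun t => riesz qs t * dirichlet k sigma N t) <=
    mean J (/ INR n) (fun t => (Y + e) * riesz qs t + (Q * A0) *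
      (if Rlt_dec (Rabs t) (INR D * / INR n) then 1 else 0))).
  { apply mean_le; auto. intros j l Hj Hl. set (t := (INR j - INR l) * / INR n).
    assert (HW := riesz_bounds qs t).
    assert (HDn : INR D * / INR n = Q ^ 3) by (rewrite HD; field; lra).
    destruct (Rlt_dec (Rabs t) (INR D * / INR n)) as [Hlt|Hge].
    - rewrite Rmult_1_r. assert (0 <= (Y + e) * riesz qs t) by (apply Rmult_le_pos; lra).
      apply Rle_trans with (riesz qs t * A0); [apply Rmult_le_compat_l; [lra|apply HA0]|].
      apply Rle_trans with (Q * A0); [apply Rmult_le_compat_r; lra|lra].
    - rewrite Rmult_0_r, Rplus_0_r, (Rmult_comm (Y + e)). apply Rmult_le_compat_l; [lra|].
      rewrite <- dirichlet_Rabs. apply Herr. split; [lra|].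
      unfold t. rewrite Rabs_mult, (Rabs_pos_eq (/ INR n)) by lra.
      apply lt_INR in Hj, Hl. assert (T1 := pos_INR j). assert (T2 := pos_INR l).
      replace (Q ^ 13) with (INR J * / INR n) by (rewrite HJ; field; lra).
      apply Rmult_le_compat_r; [lra|]. apply Rabs_le. lra. }
  rewrite mean_plus, !mean_scal in Hmain.
  assert (Hind := mean_indicator J (/ INR n) HJ0 D Hi0).
  assert (HW : mean J (/ INR n) (riesz qs) <= 2).
  { eapply Rle_trans; [apply mean_riesz_le; auto|].
    - assert (T : 0 < INR J) by auto. apply INR_lt. simpl (INR 0). lra.
    - apply Rle_trans with (ln Q); [apply ln_le; lra|].
      unfold Q. rewrite ln_pow by lra.
      assert (L2 := ln2_le_1).
      nra.
    - assert (T : 32 * (INR n * INR (prodl qs) / INR J) ^ 2 * 2 ^ length qs <= 1); [|lra].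
      apply Rle_trans with (32 * (/ Q ^ 12) ^ 2 * Q).
      + assert (S0 : 0 <= INR n * INR (prodl qs) / INR J <= / Q ^ 12).
        { split; [apply Rdiv_le_0_compat; auto; apply Rmult_le_pos; lra|].
          rewrite HJ. apply Rle_trans with (INR n * Q / (INR n * Q ^ 13)).
          - apply Rmult_le_compat_r; [left; apply Rinv_0_lt_compat; rewrite <- HJ; auto|].
            apply Rmult_le_compat_l; lra.
          - right. field. lra. }
        assert (S1 : (INR n * INR (prodl qs) / INR J) ^ 2 <= (/ Q ^ 12) ^ 2) by (apply pow_incr; lra).
        assert (S2 := pow2_ge_0 (INR n * INR (prodl qs) / INR J)).
        assert (0 < 2 ^ length qs) by (apply pow_lt; lra).
        apply Rmult_le_compat; lra.
      + replace (32 * (/ Q ^ 12) ^ 2 * Q) with (32 / Q ^ 23) by (field; lra).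
        apply Rmult_le_reg_r with (Q ^ 23); [apply HQp|].
        unfold Rdiv. rewrite Rmult_assoc, Rinv_l by (assert (T := HQp 23%nat); lra).
        assert (2 ^ 5 <= Q ^ 5) by (apply pow_incr; lra).
        assert (Q ^ 5 <= Q ^ 23) by (apply Rle_pow; [lra|lia]). simpl (2 ^ 5) in H. lra. }
  assert (Hlow : Q * A0 * mean J (/ INR n)
     (fun t => if Rlt_dec (Rabs t) (INR D * / INR n) then 1 else 0) <= 1).
  { apply Rle_trans with (Q * A0 * (2 * INR D / INR J)).
    - apply Rmult_le_compat_l; auto. apply Rmult_le_pos; lra.
    - rewrite HD, HJ. unfold A0.
      replace (Q * (4 * G * Q ^ 8) * (2 * (INR n * Q ^ 3) / (INR n * Q ^ 13))) with (8 * G / Q)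
        by (field; lra).
      apply Rmult_le_reg_r with Q; [lra|]. unfold Rdiv. rewrite Rmult_assoc, Rinv_l by lra.
      assert (0 <= 3 * B * G) by (apply Rmult_le_pos; lra). lra. }
  assert (Hup := mean_riesz_dirichlet J (/ INR n) qs k sigma N Hi HJ0).
  specialize (Hup ltac:(apply INR_le; rewrite HN;
     assert (T := Rle_pow Q 1 16 ltac:(lra) ltac:(lia)); rewrite pow_1 in T; lra)).
  assert (Hprod := divs_prod_lower qs sigma (2 * INR n) ltac:(lra) ltac:(lra)).
  specialize (Hprod ltac:(intros r Hr; destruct (Hq r Hr) as [R1 R2]; split; auto;
     apply le_INR in R2; rewrite mult_INR in R2; exact R2)).
  fold E in Hprod.
  assert (Hln : 0 <= ln 2 ^ k) by (apply pow_le, ln_ge0; lra).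
  assert (HE : ln 2 ^ k * (E - 1) <=
    ln 2 ^ k * (fold_right (fun q w => (1 + Rpower (INR q) (- sigma) / 2) * w) 1 qs - 1))
    by (apply Rmult_le_compat_l; lra).
  assert (HYW : (Y + e) * mean J (/ INR n) (riesz qs) <= (Y + 1) * 2).
  { apply Rle_trans with ((Y + e) * 2); [apply Rmult_le_compat_l; lra|lra]. }
  assert (EY : 2 * Y + 4 = ln 2 ^ k * (E - 1)) by (unfold Y; field).
  lra.
Qed.

(** The maximality of K gives K >= n / (4 log n), and (2n)^(theta - 1) >= n^(theta - 1) / 2. With
    the 4 of the resonance bound the constant is 32 = 4 * 2 * 4. *)
Lemma zeta_deriv_large k : exists n0, forall n, (n0 <= n)%nat ->
  forall theta, 0 <= theta <= / 16 ->
  exists t, (2 ^ n) ^ 3 <= t <= (2 ^ n) ^ 13 /\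
    ln 2 ^ k * (exp (exp (ln (INR n) * theta) / (32 * ln (INR n))) - 1)
    <= 2 * Cmod (zeta_deriv k (1 - theta, t)) + 4.
Proof.
  destruct (zeta_deriv_resonance k) as [n1 H].
  (* 576 = 24^2: from log n = 2 log(sqrt n) <= 2 sqrt n it follows that log n <= n / 12, and log n
     >= 4 holds as well. *)
  exists (n1 + 576)%nat. intros n Hn theta Hth.
  destruct (many_primes n ltac:(lia)) as [qs [Hi [Hq [Hle Hlt]]]].
  destruct (H n ltac:(lia) qs (1 - theta) Hi Hq Hle ltac:(lra)) as [t [Ht HT]].
  exists t; split; auto. eapply Rle_trans; [|exact HT].
  apply Rmult_le_compat_l; [apply pow_le, ln_ge0; lra|].
  apply Rplus_le_compat_r. apply exp_monotone.
  set (x := INR n). assert (Hx : 576 <= x).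
  { unfold x. replace 576 with (INR 576) by (simpl; ring). apply le_INR; lia. }
  set (K := INR (length qs)). set (U := ln x).
  assert (HU0 : 4 <= U).
  { unfold U. rewrite <- (ln_exp 4). apply ln_le; [apply exp_pos|].
    replace 4 with (1 + 1 + 1 + 1) by ring. rewrite !exp_plus.
    assert (E3 := exp_le_3). assert (E0 := exp_pos 1).
    assert (exp 1 * exp 1 <= 9) by nra. nra. }
  assert (HU1 : U <= x / 12).
  { unfold U. rewrite <- (sqrt_sqrt x) at 1 by lra.
    assert (Hs : 24 <= sqrt x).
    { rewrite <- (sqrt_square 24) by lra. apply sqrt_le_1_alt. lra. }
    rewrite ln_mult by lra.
    assert (ln (sqrt x) <= sqrt x).
    { assert (E := exp_ineq1_le (ln (sqrt x))). rewrite exp_ln in E by lra. lra. }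
    assert (Hss := sqrt_sqrt x ltac:(lra)). nra. }
  assert (HK : x / (4 * U) <= K).
  { assert (A : x * ln 2 <= (K + 1) * (ln 2 + U)).
    { apply lt_INR in Hlt. rewrite !pow_INR, mult_INR in Hlt. simpl (INR 2) in Hlt.
      replace (1 + 1) with 2 in Hlt by ring. fold x in Hlt.
      apply ln_increasing in Hlt; [|apply pow_lt; lra].
      rewrite !ln_pow, S_INR, ln_mult in Hlt by lra. fold K U x in Hlt. lra. }
    assert (L1 := ln_lt_2). assert (L2 := ln2_le_1).
    assert (HK0 : 0 <= K) by apply pos_INR.
    assert (A2 : x / 2 <= (K + 1) * (5 / 4 * U)).
    { apply Rle_trans with (x * ln 2); [nra|]. eapply Rle_trans; [exact A|].
      apply Rmult_le_compat_l; lra. }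
    apply Rmult_le_reg_r with (4 * U); [lra|].
    unfold Rdiv. rewrite Rmult_assoc, Rinv_l by lra. lra. }
  assert (HR : Rpower x (theta - 1) / 2 <= Rpower (2 * x) (- (1 - theta))).
  { replace (- (1 - theta)) with (theta - 1) by ring.
    rewrite <- Rpower_mult_distr by lra.
    assert (A : / 2 <= Rpower 2 (theta - 1)).
    { replace (/ 2) with (Rpower 2 (- (1))) by (rewrite Rpower_Ropp, Rpower_1 by lra; reflexivity).
      apply Rle_Rpower; lra. }
    assert (B := exp_pos ((theta - 1) * ln x)).
    change (exp ((theta - 1) * ln x)) with (Rpower x (theta - 1)) in B. nra. }
  assert (EX : exp (U * theta) = x * Rpower x (theta - 1)).
  { rewrite <- (Rpower_1 x) at 1 by lra. rewrite <- Rpower_plus.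
    unfold Rpower, U. f_equal. ring. }
  rewrite EX. assert (B := exp_pos ((theta - 1) * ln x)).
  change (exp ((theta - 1) * ln x)) with (Rpower x (theta - 1)) in B.
  set (R0 := Rpower x (theta - 1)) in *.
  replace (x * R0 / (32 * U)) with (x / (4 * U) * (R0 / 2 / 4)) by (field; lra).
  apply Rmult_le_compat; try lra.
  apply Rdiv_le_0_compat; lra.
Qed.

(** * From large values to the four pairs *)

Lemma exp_3_ge_13 : 13 <= exp 3.
Proof.
  assert (E : exp 3 = exp (/ 4) ^ 12).
  { rewrite <- Rpower_pow by apply exp_pos. unfold Rpower. rewrite ln_exp.
    f_equal. simpl; field. }
  rewrite E.
  assert (H := exp_ineq1_le (/ 4)).
  apply Rle_trans with ((5 / 4) ^ 12); [simpl; lra|]. apply pow_incr; lra.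
Qed.

(** The height t is only located between 2^(3n) and 2^(13n), so with U = log n the number u = loglog
    t is known only up to U <= u <= U + 3, because 13 <= e^3. Hence one theta must serve a whole
    window. Every F is written as exp(f(loglog t)). *)
Lemma omega_from_growth k (f s : R -> R) :
  (forall C, exists U0, forall U, U0 <= U -> exists theta, 0 <= theta <= / 16 /\
     forall u, U <= u <= U + 3 ->
       s u <= 1 - theta /\ 0 <= f u /\ f u + C <= exp (U * theta) / (32 * U)) ->
  omega_pair k (fun t => exp (f (loglog t))) (fun t => s (loglog t)).
Proof.
  intros H t0 Ht0. apply limsup_Sigma_ge1. intros c t1 Hc.
  assert (L1 := ln_lt_2). assert (L2 := ln2_le_1).
  assert (Hlk : 0 < ln 2 ^ k) by (apply pow_lt; lra).
  (* Since exp(f + C) >= F (1 + C), multiplication by ln 2 ^ k yields an extra 10 F. As F >= 1, this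
     pays for the additive 4 and the factor 2 in [zeta_deriv_large]. *)
  set (C := 10 / ln 2 ^ k).
  destruct (H C) as [U0 HU]. destruct (zeta_deriv_large k) as [n0 Hz].
  destruct (INR_unbounded (Rmax (Rmax t0 t1) (Rmax 1 (Rmax (exp U0) (INR n0))))) as [n Hn].
  assert (Hn1 : t0 < INR n /\ t1 < INR n /\ 1 < INR n /\ exp U0 < INR n /\ INR n0 < INR n).
  { repeat split; eapply Rle_lt_trans; try exact Hn.
    - eapply Rle_trans; [|apply Rmax_l]. apply Rmax_l.
    - eapply Rle_trans; [|apply Rmax_l]. apply Rmax_r.
    - eapply Rle_trans; [|apply Rmax_r]. apply Rmax_l.
    - eapply Rle_trans; [|apply Rmax_r]. eapply Rle_trans; [|apply Rmax_r]. apply Rmax_l.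
    - eapply Rle_trans; [|apply Rmax_r]. eapply Rle_trans; [|apply Rmax_r]. apply Rmax_r. }
  destruct Hn1 as [N1 [N2 [N3 [N4 N5]]]]. set (x := INR n) in *.
  set (U := ln x).
  destruct (HU U) as [theta [Hth Hu]].
  { unfold U. rewrite <- (ln_exp U0). apply ln_le; [apply exp_pos|lra]. }
  destruct (Hz n ltac:(apply INR_le; fold x; lra) theta Hth) as [t [Ht HT]].
  assert (HQ : x <= 2 ^ n).
  { assert (P := poly n 1 ltac:(lra)). fold x in P. replace (1 + 1) with 2 in P by ring. lra. }
  assert (Htx : x <= t).
  { eapply Rle_trans; [exact HQ|]. eapply Rle_trans; [|apply Ht].
    rewrite <- (pow_1 (2 ^ n)) at 1. apply Rle_pow; [lra|lia]. }
  assert (Hlt : x <= ln t <= 13 * x).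
  { assert (HQ0 : 0 < 2 ^ n) by lra. destruct Ht as [T1 T2].
    apply ln_le in T1; [|now apply pow_lt]. apply ln_le in T2; [|lra].
    rewrite !ln_pow in T1, T2 by (auto; lra). fold x in T1, T2.
    simpl (INR 3) in T1. replace (INR 13) with 13 in T2 by (simpl; ring). nra. }
  assert (Hll : U <= loglog t <= U + 3).
  { unfold loglog, U. split; [apply ln_le; lra|].
    replace 3 with (ln (exp 3)) by apply ln_exp.
    rewrite <- ln_mult by (try apply exp_pos; lra).
    apply ln_le; [lra|]. assert (E := exp_3_ge_13). nra. }
  destruct (Hu _ Hll) as [S1 [S2 S3]].
  exists (1 - theta, t), t. split; [|split].
  - unfold Sigma. simpl. split; split; lra.
  - simpl. lra.
  - simpl Im. set (Z := Cmod _) in *. set (F := exp (f (loglog t))).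
    assert (HF1 : 1 <= F).
    { unfold F. rewrite <- exp_0. now apply exp_monotone. }
    assert (HF : F <= Z).
    { fold x U in HT.
      assert (E : F * (1 + C) <= exp (exp (U * theta) / (32 * U))).
      { apply Rle_trans with (exp (f (loglog t) + C)); [|now apply exp_monotone].
        rewrite exp_plus. apply Rmult_le_compat_l; [left; apply exp_pos|apply exp_ineq1_le]. }
      apply (Rmult_le_compat_l (ln 2 ^ k)) in E; [|lra].
      replace (ln 2 ^ k * (F * (1 + C))) with (F * (ln 2 ^ k + 10)) in E
        by (unfold C; field; lra).
      nra. }
    apply Rlt_le_trans with 1; [lra|].
    apply Rmult_le_reg_r with F; [lra|].
    unfold Rdiv. rewrite Rmult_assoc, Rinv_l by lra. lra.
Qed.

Lemma log_growth k c K : 0 < c -> exists U0, 1 <= U0 /\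
  forall U, U0 <= U -> K * (1 + ln U) ^ k <= Rpower U c.
Proof.
  intros Hc. destruct (ln_pow_bound k (c / 2)) as [B [HB H]]; [lra|].
  set (M := Rabs K * B). assert (HK := Rabs_pos K).
  assert (HM : 0 <= M) by now apply Rmult_le_pos.
  exists (exp (2 * M / c)). split.
  { rewrite <- exp_0. apply exp_monotone. apply Rdiv_le_0_compat; lra. }
  intros U HU.
  assert (HU1 : 1 <= U).
  { eapply Rle_trans; [|exact HU]. rewrite <- exp_0. apply exp_monotone.
    apply Rdiv_le_0_compat; lra. }
  assert (HMU : M <= Rpower U (c / 2)).
  { unfold Rpower. apply ln_le in HU; [|apply exp_pos]. rewrite ln_exp in HU.
    apply Rle_trans with (exp M); [assert (E := exp_ineq1_le M); lra|].
    apply exp_monotone. apply (Rmult_le_compat_l (c / 2)) in HU; [|lra].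
    replace (c / 2 * (2 * M / c)) with M in HU by (field; lra). exact HU. }
  assert (HX := exp_pos (c / 2 * ln U)). change (exp (c / 2 * ln U)) with (Rpower U (c / 2)) in HX.
  replace (Rpower U c) with (Rpower U (c / 2) * Rpower U (c / 2))
    by (rewrite <- Rpower_plus; f_equal; lra).
  apply Rle_trans with (M * Rpower U (c / 2)); [|apply Rmult_le_compat_r; lra].
  assert (HL := ln_ge0 U HU1).
  assert (HL0 : 0 <= (1 + ln U) ^ k) by (apply pow_le; lra).
  apply Rle_trans with (Rabs K * (1 + ln U) ^ k).
  { apply Rmult_le_compat_r; auto. apply Rle_abs. }
  unfold M. rewrite Rmult_assoc. apply Rmult_le_compat_l; auto.
Qed.

(** For a doubly exponential F the comparison takes place one exponential lower: a gap of order log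
    U between inner exponents pays for the denominator 32 U and the constant C. *)
Lemma exp_gap U a b C : 1 <= U -> 0 <= a ->
  a + (1 + 32 * (1 + Rabs C)) * (1 + ln U) <= b -> exp a + C <= exp b / (32 * U).
Proof.
  intros HU Ha Hb. assert (HC := Rabs_pos C). assert (HC' := Rle_abs C).
  assert (HL := ln_ge0 U HU). set (M := 32 * (1 + Rabs C)) in *.
  assert (HM : 32 <= M) by (unfold M; lra).
  assert (E : exp a * (U * M) <= exp b).
  { apply Rle_trans with (exp (a + (ln U + M))); [|apply exp_monotone; nra].
    rewrite !exp_plus, exp_ln by lra. apply Rmult_le_compat_l; [left; apply exp_pos|].
    apply Rmult_le_compat_l; [lra|]. assert (Q := exp_ineq1_le M). lra. }
  assert (E1 : 1 <= exp a) by (rewrite <- exp_0; now apply exp_monotone).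
  apply Rmult_le_reg_r with (32 * U); [lra|].
  unfold Rdiv. rewrite Rmult_assoc, Rinv_l, Rmult_1_r by lra.
  eapply Rle_trans; [|exact E]. unfold M.
  replace (exp a * (U * (32 * (1 + Rabs C)))) with ((exp a + exp a * Rabs C) * (32 * U)) by ring.
  apply Rmult_le_compat_r; [lra|]. apply Rplus_le_compat_l. nra.
Qed.

Lemma ln_le_double U u : 1 <= U -> U <= u <= 2 * U -> 0 <= ln U <= ln u /\ ln u <= 1 + ln U.
Proof.
  intros HU Hu. assert (HL := ln_ge0 U HU). split; [split; auto; apply ln_le; lra|].
  apply Rle_trans with (ln (2 * U)); [apply ln_le; lra|].
  rewrite ln_mult by lra. assert (L := ln2_le_1). lra.
Qed.

(** The price of choosing theta with the right end U + 3 of the window in the denominator. *)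
Lemma three_quarters U b : 9 <= U -> 0 <= b -> 3 / 4 * b <= U * (b / (U + 3)).
Proof.
  intros HU Hb. replace (U * (b / (U + 3))) with (U / (U + 3) * b) by (field; lra).
  apply Rmult_le_compat_r; auto.
  apply Rmult_le_reg_r with (U + 3); [lra|]. unfold Rdiv at 2.
  rewrite Rmult_assoc, Rinv_l by lra. lra.
Qed.

Lemma log_over_antitone U u b : 9 <= U -> U <= u <= U + 3 -> 0 <= b ->
  b * ln U / (U + 3) <= b * (ln u / u).
Proof.
  intros HU Hu Hb. destruct (ln_le_double U u) as [[L0 L1] _]; [lra|lra|].
  unfold Rdiv. rewrite Rmult_assoc. apply Rmult_le_compat_l; auto.
  apply Rmult_le_compat; auto.
  - left; apply Rinv_0_lt_compat; lra.
  - apply Rinv_le_contravar; lra.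
Qed.

(** Here exp(U theta) >= U^(3 (4 + eps) / 4) >= U^(3 + eps/2). One power of U pays for the
    denominator 32 U, another for the constants, and U^(1 + eps/2) remains. *)
Lemma omega_power k eps delta : 0 < eps -> 0 < delta ->
  omega_pair k (fun t => exp (Rpower (loglog t) (1 + eps / 2 - delta)))
    (fun t => 1 - (4 + eps) * (logloglog t / loglog t)).
Proof.
  intros He Hd.
  apply (omega_from_growth k (fun u => Rpower u (1 + eps / 2 - delta))
    (fun u => 1 - (4 + eps) * (ln u / u))). intros C.
  destruct (log_growth 1 1 (16 * (4 + eps))) as [U1 [HU1 G1]]; [lra|].
  assert (HC := Rabs_pos C). assert (HC' := Rle_abs C).
  set (b := 1 + eps / 2). set (P := Rpower 2 b). assert (HP : 0 < P) by apply exp_pos.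
  exists (Rmax U1 (Rmax 9 (32 * (P + Rabs C)))). intros U HU.
  assert (A1 : U1 <= U) by (eapply Rle_trans; [apply Rmax_l|exact HU]).
  assert (A2 : 9 <= U)
    by (eapply Rle_trans; [|exact HU]; eapply Rle_trans; [|apply Rmax_r]; apply Rmax_l).
  assert (A3 : 32 * (P + Rabs C) <= U)
    by (eapply Rle_trans; [|exact HU]; eapply Rle_trans; [|apply Rmax_r]; apply Rmax_r).
  clear HU. specialize (G1 U A1). rewrite pow_1, Rpower_1 in G1 by lra.
  assert (HL := ln_ge0 U ltac:(lra)).
  assert (Hb0 : 0 <= (4 + eps) * ln U) by (apply Rmult_le_pos; lra).
  exists ((4 + eps) * ln U / (U + 3)). split.
  { split; [apply Rdiv_le_0_compat; lra|].
    apply Rmult_le_reg_r with (U + 3); [lra|]. unfold Rdiv. rewrite Rmult_assoc, Rinv_l by lra. lra. }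
  intros u Hu. split; [|split].
  - assert (Q := log_over_antitone U u (4 + eps) A2 Hu ltac:(lra)). lra.
  - left; apply exp_pos.
  - set (X := Rpower U b).
    assert (HX : 1 <= X).
    { unfold X. rewrite <- (Rpower_O U) by lra. apply Rle_Rpower; unfold b; lra. }
    assert (Hf : Rpower u (b - delta) <= P * X).
    { apply Rle_trans with (Rpower (2 * U) b).
      - apply Rle_trans with (Rpower u b); [apply Rle_Rpower; unfold b; lra|].
        apply Rle_Rpower_l; unfold b; lra.
      - right. unfold P, X. symmetry. apply Rpower_mult_distr; lra. }
    assert (HE : U * (U * X) <= exp (U * ((4 + eps) * ln U / (U + 3)))).
    { replace (U * (U * X)) with (exp ((2 + b) * ln U)).
      - apply exp_monotone. eapply Rle_trans; [|apply three_quarters; lra].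
        unfold b. nra.
      - rewrite !Rmult_plus_distr_r, exp_plus. change (exp (b * ln U)) with X.
        replace (2 * ln U) with (ln U + ln U) by ring. rewrite exp_plus, exp_ln by lra. ring. }
    apply Rle_div_r; [lra|].
    eapply Rle_trans; [|exact HE].
    apply Rle_trans with ((P * X + Rabs C * X) * (32 * U)).
    { apply Rmult_le_compat_r; [lra|].
      assert (Rabs C * 1 <= Rabs C * X) by (apply Rmult_le_compat_l; lra). lra. }
    replace ((P * X + Rabs C * X) * (32 * U)) with (U * X * (32 * (P + Rabs C))) by ring.
    replace (U * (U * X)) with (U * X * U) by ring. apply Rmult_le_compat_l; [|lra].
    apply Rmult_le_pos; lra.
Qed.

(** Here exp(U theta) >= U^(3/2), and division by 32 U leaves a multiple of sqrt U, which exceeds A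
    log u + C. [Rpower] unfolds to exp(A log u), and [2 + 0] is the instance eta = 0. *)
Lemma omega_log_power k A : 0 < A ->
  omega_pair k (fun t => Rpower (loglog t) A)
    (fun t => 1 - (2 + 0) * (logloglog t / loglog t)).
Proof.
  intros HA.
  apply (omega_from_growth k (fun u => A * ln u) (fun u => 1 - (2 + 0) * (ln u / u))). intros C.
  assert (HC := Rabs_pos C). assert (HC' := Rle_abs C).
  destruct (log_growth 1 1 32) as [U1 [HU1 G1]]; [lra|].
  destruct (log_growth 1 (/ 2) (32 * (A + Rabs C))) as [U2 [HU2 G2]]; [lra|].
  exists (Rmax U1 (Rmax 9 U2)). intros U HU.
  assert (A1 : U1 <= U) by (eapply Rle_trans; [apply Rmax_l|exact HU]).
  assert (A2 : 9 <= U)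
    by (eapply Rle_trans; [|exact HU]; eapply Rle_trans; [|apply Rmax_r]; apply Rmax_l).
  assert (A3 : U2 <= U)
    by (eapply Rle_trans; [|exact HU]; eapply Rle_trans; [|apply Rmax_r]; apply Rmax_r).
  clear HU. specialize (G1 U A1). specialize (G2 U A3). rewrite pow_1 in G1, G2.
  rewrite Rpower_1 in G1 by lra.
  assert (HL := ln_ge0 U ltac:(lra)).
  exists (2 * ln U / (U + 3)). split.
  { split; [apply Rdiv_le_0_compat; lra|].
    apply Rmult_le_reg_r with (U + 3); [lra|]. unfold Rdiv. rewrite Rmult_assoc, Rinv_l by lra. lra. }
  intros u Hu. destruct (ln_le_double U u) as [[_ L1] L2]; [lra|lra|]. split; [|split].
  - assert (Q := log_over_antitone U u 2 A2 Hu ltac:(lra)). lra.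
  - apply Rmult_le_pos; lra.
  - set (X := Rpower U (/ 2)) in *.
    assert (HE : U * X <= exp (U * (2 * ln U / (U + 3)))).
    { replace (U * X) with (exp ((1 + / 2) * ln U)).
      - apply exp_monotone. eapply Rle_trans; [|apply three_quarters; lra]. lra.
      - rewrite Rmult_plus_distr_r, exp_plus, Rmult_1_l, exp_ln by lra. reflexivity. }
    apply Rle_div_r; [lra|].
    eapply Rle_trans; [|exact HE].
    apply Rle_trans with (U * (32 * (A + Rabs C) * (1 + ln U))).
    2: { apply Rmult_le_compat_l; lra. }
    replace ((A * ln u + C) * (32 * U)) with (U * (32 * (A * ln u + C))) by ring.
    apply Rmult_le_compat_l; [lra|]. nra.
Qed.

(** In units of V = U / log U the inner exponent of F is at most 5/4 V, and that of the lower bound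
    is at least 7/4 V. The gap V/2 exceeds every multiple of 1 + log U. *)
Lemma omega_exp_quotient k :
  omega_pair k (fun t => exp (exp (loglog t / logloglog t)))
    (fun t => 1 - (2 + 0) / logloglog t).
Proof.
  apply (omega_from_growth k (fun u => exp (u / ln u)) (fun u => 1 - (2 + 0) / ln u)). intros C.
  set (M := 1 + 32 * (1 + Rabs C)).
  destruct (log_growth 2 1 (2 * M)) as [U1 [HU1 G1]]; [lra|].
  (* From 12 on U + 3 <= 5/4 U; from exp 32 on theta <= 1/16 and log(U + 3) <= 8/7 log U. *)
  exists (Rmax U1 (Rmax 12 (exp 32))). intros U HU.
  assert (A1 : U1 <= U) by (eapply Rle_trans; [apply Rmax_l|exact HU]).
  assert (A2 : 12 <= U)
    by (eapply Rle_trans; [|exact HU]; eapply Rle_trans; [|apply Rmax_r]; apply Rmax_l).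
  assert (A3 : exp 32 <= U)
    by (eapply Rle_trans; [|exact HU]; eapply Rle_trans; [|apply Rmax_r]; apply Rmax_r).
  clear HU. specialize (G1 U A1). rewrite Rpower_1 in G1 by lra.
  apply ln_le in A3; [|apply exp_pos]. rewrite ln_exp in A3.
  destruct (ln_le_double U (U + 3)) as [[_ L1] L2]; [lra|lra|].
  exists (2 / ln (U + 3)). split.
  { split; [apply Rdiv_le_0_compat; lra|].
    apply Rmult_le_reg_r with (ln (U + 3)); [lra|].
    unfold Rdiv. rewrite Rmult_assoc, Rinv_l by lra. lra. }
  intros u Hu. destruct (ln_le_double U u) as [[_ L3] _]; [lra|lra|].
  assert (L4 : ln u <= ln (U + 3)) by (apply ln_le; lra).
  split; [|split].
  - assert (2 / ln (U + 3) <= (2 + 0) / ln u); [|lra].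
    rewrite Rplus_0_r. apply Rmult_le_compat_l; [lra|]. apply Rinv_le_contravar; lra.
  - left; apply exp_pos.
  - set (V := U / ln U).
    assert (HV : 2 * M * (1 + ln U) <= V).
    { unfold V. apply Rmult_le_reg_r with (ln U); [lra|].
      unfold Rdiv. rewrite (Rmult_assoc U), Rinv_l, Rmult_1_r by lra.
      eapply Rle_trans; [|exact G1].
      assert (HC := Rabs_pos C). simpl.
      assert (0 <= 2 * M * (1 + ln U)) by (unfold M; nra). nra. }
    assert (Hu1 : u / ln u <= 5 / 4 * V).
    { apply Rle_trans with (5 / 4 * U * / ln U); [|right; unfold V; field; lra].
      apply Rmult_le_compat; try lra.
      - left; apply Rinv_0_lt_compat; lra.
      - apply Rinv_le_contravar; lra. }
    assert (Hu2 : 7 / 4 * V <= U * (2 / ln (U + 3))).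
    { apply Rle_trans with (U * (2 * / (8 / 7 * ln U))); [right; unfold V; field; lra|].
      apply Rmult_le_compat_l; [lra|]. apply Rmult_le_compat_l; [lra|].
      apply Rinv_le_contravar; lra. }
    apply exp_gap; [lra|apply Rdiv_le_0_compat; lra|]. fold M. lra.
Qed.

(** In units of v = (U + 3)^alpha the inner exponent of F is at most v, while U theta = 2 v U / (U +
    3) >= 3/2 v. The gap v/2 exceeds every multiple of 1 + log U. *)
Lemma omega_exp_power k alpha : 0 < alpha < 1 ->
  omega_pair k (fun t => exp (exp (Rpower (loglog t) alpha)))
    (fun t => 1 - (2 + 0) / Rpower (loglog t) (1 - alpha)).
Proof.
  intros Ha.
  apply (omega_from_growth k (fun u => exp (Rpower u alpha))
    (fun u => 1 - (2 + 0) / Rpower u (1 - alpha))). intros C.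
  set (M := 1 + 32 * (1 + Rabs C)).
  destruct (log_growth 1 alpha (2 * M)) as [U1 [HU1 G1]]; [lra|].
  destruct (log_growth 0 (1 - alpha) 32) as [U2 [HU2 G2]]; [lra|].
  exists (Rmax U1 (Rmax 9 U2)). intros U HU.
  assert (A1 : U1 <= U) by (eapply Rle_trans; [apply Rmax_l|exact HU]).
  assert (A2 : 9 <= U)
    by (eapply Rle_trans; [|exact HU]; eapply Rle_trans; [|apply Rmax_r]; apply Rmax_l).
  assert (A3 : U2 <= U)
    by (eapply Rle_trans; [|exact HU]; eapply Rle_trans; [|apply Rmax_r]; apply Rmax_r).
  clear HU. specialize (G1 U A1). specialize (G2 U A3). rewrite pow_1 in G1. simpl pow in G2.
  assert (HU3 : Rpower U (1 - alpha) <= Rpower (U + 3) (1 - alpha)) by (apply Rle_Rpower_l; lra).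
  set (W := Rpower (U + 3) (1 - alpha)) in *.
  exists (2 / W). split.
  { split; [apply Rdiv_le_0_compat; lra|].
    apply Rmult_le_reg_r with W; [lra|]. unfold Rdiv. rewrite Rmult_assoc, Rinv_l by lra. lra. }
  intros u Hu. split; [|split].
  - assert (2 / W <= (2 + 0) / Rpower u (1 - alpha)); [|lra].
    rewrite Rplus_0_r. apply Rmult_le_compat_l; [lra|].
    apply Rinv_le_contravar; [apply exp_pos|]. apply Rle_Rpower_l; lra.
  - left; apply exp_pos.
  - set (v := Rpower (U + 3) alpha). assert (Hv0 : 0 < v) by apply exp_pos.
    assert (HWv : W = (U + 3) / v).
    { unfold W. replace (1 - alpha) with (1 + - alpha) by ring.
      rewrite Rpower_plus, Rpower_1, Rpower_Ropp by lra. reflexivity. }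
    assert (Hv : 2 * M * (1 + ln U) <= v).
    { eapply Rle_trans; [exact G1|]. apply Rle_Rpower_l; lra. }
    assert (Hu1 : Rpower u alpha <= v) by (apply Rle_Rpower_l; lra).
    assert (Hu2 : 3 / 2 * v <= U * (2 / W)).
    { rewrite HWv. replace (U * (2 / ((U + 3) / v))) with (U * (2 * v / (U + 3))) by (field; lra).
      eapply Rle_trans; [|apply three_quarters; lra]. lra. }
    apply exp_gap; [lra|left; apply exp_pos|]. fold M. lra.
Qed.

Theorem theorem1 :
  forall (n : nat) (eps delta A alpha : R),
    0 < eps -> 0 < delta -> 0 < A -> 0 < alpha < 1 ->
    omega_pair n
      (fun t => exp (Rpower (loglog t) (1 + eps / 2 - delta)))
      (fun t => 1 - (4 + eps) * (logloglog t / loglog t))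
    /\ (exists eta : R -> R, is_lim eta p_infty 0 /\
          omega_pair n
            (fun t => exp (exp (loglog t / logloglog t)))
            (fun t => 1 - (2 + eta t) / logloglog t))
    /\ (exists eta : R -> R, is_lim eta p_infty 0 /\
          omega_pair n
            (fun t => Rpower (loglog t) A)
            (fun t => 1 - (2 + eta t) * (logloglog t / loglog t)))
    /\ (exists eta : R -> R, is_lim eta p_infty 0 /\
          omega_pair n
            (fun t => exp (exp (Rpower (loglog t) alpha)))
            (fun t => 1 - (2 + eta t) / Rpower (loglog t) (1 - alpha))).
Proof.
  intros n eps delta A alpha He Hd HA Hal.
  split; [now apply omega_power|].
  split; [|split]; exists (fun _ => 0); (split; [apply is_lim_const|]).
  - apply omega_exp_quotient.
  - now apply omega_log_power.
  - now apply omega_exp_power.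
Qed.
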